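(* Let $(F|L,v)$ be a finite valued inertial extension. Let $\eta\in\mathcal O_F$ be an element such that $F=L(\eta)$, the monic minimal polynomial $h(X)$ of $\eta$ over $L$ lies in $\mathcal O_L[X]$, and $\eta$ and $h'(\eta)$ are units in $\mathcal O_F$. Set $\mathfrak n:=\mathfrak m_F\cap\mathcal O_L[\eta]$. Then the following conditions are equivalent: (i) $\mathcal O_F$ is a finitely generated $\mathcal O_L$-algebra; (ii) there exists a unit $u$ of $\mathcal O_F$ with $u\in\mathcal O_L[\eta]$ such that $\mathcal O_F=\mathcal O_L[\eta,1/u]$; (iii) there are elements $r,s\in\mathcal O_F$, henselian over $\mathcal O_L$, such that $\mathcal O_F=\mathcal O_L[\eta,r,s]$; (iv) there exists an element $u\in\mathcal O_L[\eta]\setminus\mathfrak n$ such that $u$ belongs to every prime ideal of $\mathcal O_L[\eta]$ not contained in $\mathfrak n$, i.e., $\bigcap_{\mathfrak p\in\mathcal S}\mathfrak p\not\subseteq\mathfrak n$, where $\mathcal S=\{\mathfrak p\in\mathrm{Spec}(\mathcal O_L[\eta])\mid\mathfrak p\not\subseteq\mathfrak n\}$; (v) for every chain of prime ideals $(\mathfrak p_\lambda)_{\lambda\in\Lambda}$ of $\mathcal O_L[\eta]$, if $\mathfrak p_\lambda\not\subseteq\mathfrak n$ for every $\lambda\in\Lambda$, then $\bigcap_{\lambda\in\Lambda}\mathfrak p_\lambda\not\subseteq\mathfrak n$.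
   Context: A valued field extension $(F|L,v)$ is a field extension $F|L$ together with a (Krull) valuation $v$ on $F$ (arbitrary value group); its restriction to $L$ is again denoted $v$. $\mathcal O_F$ and $\mathfrak m_F$ are the valuation ring of $v$ on $F$ and its maximal ideal, and $\mathcal O_L=\mathcal O_F\cap L$. Given a valued field $(L,v)$ and an extension of $v$ to the separable-algebraic closure $L^{\mathrm{sep}}$ (again denoted $v$, with maximal ideal $\mathfrak m_v$), let $I(\mathcal O_L)$ be the integral closure of $\mathcal O_L$ in $L^{\mathrm{sep}}$; the absolute inertia field $L^i$ is the subfield of $L^{\mathrm{sep}}$ of elements fixed by $\{\sigma\in\mathrm{Gal}(L^{\mathrm{sep}}|L)\mid \forall x\in I(\mathcal O_L):\ x-\sigma(x)\in\mathfrak m_v\cap I(\mathcal O_L)\}$. A finite valued inertial extension is a valued field extension $(F|L,v)$ with $[F:L]<\infty$ and $F\subseteq L^i$, where $L^i$ is taken with respect to an extension to $L^{\mathrm{sep}}$ of the valuation $v$ of $F$. For an extension $A\subseteq B$ of commutative rings with unity, $b\in B$ is henselian over $A$ if there is $g(X)\in A[X]$ (not necessarily monic) with $g(b)=0$ and $g'(b)$ a unit of $B$; here $A=\mathcal O_L$, $B=\mathcal O_F$. A chain is a family totally ordered by inclusion. An empty intersection of ideals is the whole ring. *)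

(* Defs.v *)
From HB Require Import structures.
From mathcomp Require Import all_boot all_order all_algebra all_field.
From mathcomp Require Import mathcomp_extra boolp classical_sets cardinality.

Set Implicit Arguments.
Unset Strict Implicit.
Unset Printing Implicit Defensive.

Import Order.TTheory GRing.Theory Num.Theory.
Local Open Scope classical_set_scope.
Local Open Scope ring_scope.

(* The value group is extended by a largest element, written None. *)
Definition vle (G : porderZmodType) (a b : option G) : bool :=
  match a, b with
  | _, None => true
  | None, Some _ => false
  | Some a, Some b => a <= b
  end.

Definition vadd (G : porderZmodType) (a b : option G) : option G :=
  match a, b with
  | Some a, Some b => Some (a + b)
  | _, _ => None
  end.

(* Nothing in porderZmodType relates the order to the addition or makes it
   total: the two axioms on the value group do. *)
Record valuation (K : fieldType) := Valuation {
  value_group : porderZmodType;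
  val :> K -> option value_group;
  value_group_total : forall a b : value_group, (a <= b) || (b <= a);
  value_group_leD :
    forall c a b : value_group, a <= b -> c + a <= c + b;
  val_eq_infty : forall x, val x = None <-> x = 0;
  valM : forall x y, val (x * y) = vadd (val x) (val y);
  valD : forall x y, vle (val x) (val (x + y)) || vle (val y) (val (x + y));
  val_surj : forall a : value_group, exists x, val x = Some a
}.

Definition val_ring (K : fieldType) (v : valuation K) : set K :=
  [set x | vle (Some 0) (v x)].

Definition val_ideal (K : fieldType) (v : valuation K) : set K :=
  [set x | ~~ vle (v x) (Some 0)].

(* w extends v along j: w \o j is v followed by an embedding of ordered
   groups. *)
Definition val_extends (F K : fieldType) (j : F -> K)
    (v : valuation F) (w : valuation K) : Prop :=
  exists e : {additive value_group v -> value_group w},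
    {mono e : a b / a <= b} /\ forall x, w (j x) = omap e (v x).

Definition separable_closure (L K : fieldType) (i : L -> K) : Prop :=
  (forall x : K, exists p : {poly L},
     separable_poly p /\ root (map_poly i p) x) /\
  (forall q : {poly K}, separable_poly q -> (1 < size q)%N ->
     exists x, root q x).

Definition integral_closure (K : fieldType) (A : set K) : set K :=
  [set x | exists p : {poly K},
     [/\ p \is monic, p \is a polyOver (mem A) & root p x]].

(* The following two definitions are relative to a separable closure
   i : L -> K and a valuation w of K; val_ring w `&` range i is the valuation
   ring of L. *)
Definition absolute_inertia_group (L K : fieldType) (i : L -> K)
    (w : valuation K) : set {rmorphism K -> K} :=
  [set s : {rmorphism K -> K} | [/\ bijective s,
       (forall a : L, s (i a) = i a) &
     let I := integral_closure (val_ring w `&` range i) in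
     forall x, I x -> (val_ideal w `&` I) (x - s x)]].

Definition absolute_inertia_field (L K : fieldType) (i : L -> K)
    (w : valuation K) : set K :=
  [set x | forall s, absolute_inertia_group i w s -> s x = x].

(* The finiteness of F over L is part of fieldExtType. *)
Definition inertial_extension (L : fieldType) (F : fieldExtType L)
    (v : valuation F) : Prop :=
  exists (K : fieldType) (j : {rmorphism F -> K}) (w : valuation K),
    [/\ separable_closure (j \o in_alg F), val_extends j v w &
        range j `<=` absolute_inertia_field (j \o in_alg F) w].

Definition base_val_ring (L : fieldType) (F : fieldExtType L)
    (v : valuation F) : set F :=
  val_ring v `&` [set x | x \in 1%VS].

(* Rings below are subrings of an ambient field K, given as subsets of it. *)
Definition ring_adjoin (K : fieldType) (A S : set K) : set K :=
  smallest [set B : set K | subring_closed (mem B)] (A `|` S).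

Definition finitely_generated_algebra (K : fieldType) (A B : set K) : Prop :=
  exists S : set K, finite_set S /\ B = ring_adjoin A S.

Definition is_unit_of (K : fieldType) (B : set K) (x : K) : Prop :=
  B x /\ exists2 y, B y & x * y = 1.

Definition henselian_over (K : fieldType) (A B : set K) (b : K) : Prop :=
  B b /\ exists g : {poly K},
    [/\ g \is a polyOver (mem A), root g b & is_unit_of B g^`().[b]].

Record prime_ideal_of (K : fieldType) (B P : set K) : Prop := PrimeIdealOf {
  prime_ideal_sub : P `<=` B;
  prime_ideal0 : P 0;
  prime_idealD : forall x y, P x -> P y -> P (x + y);
  prime_idealM : forall a x, B a -> P x -> P (a * x);
  prime_ideal_proper : ~ P 1;
  prime_ideal_prime : forall x y, B x -> B y -> P (x * y) -> P x \/ P y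
}.

(* Main.v *)
Require Import Defs.
From HB Require Import structures.
From mathcomp Require Import all_boot all_order all_algebra all_field.
From mathcomp Require Import mathcomp_extra boolp classical_sets cardinality.

Set Implicit Arguments.
Unset Strict Implicit.
Unset Printing Implicit Defensive.

Import Order.TTheory GRing.Theory Num.Theory.
Local Open Scope classical_set_scope.
Local Open Scope ring_scope.

(* Let s_1, ..., s_d be the embeddings of F over L into the separable closure,
   and w the extended valuation. Each x in F is a root of the product of the
   X - s_k x, whose coefficients lie in O_L when all s_k x lie in O_w; this
   replaces integral closures by conditions on the finitely many valuations
   w o s_k. Every such x is carried into R = O_L[eta] by multiplication with
   the unit h'(eta), so O_F is the localization of R at the prime n.
   (i) => (ii): take a common denominator of the generators.
   (ii) => (iii): u has a multiple t in R which is a unit of O_F with residue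
   that of eta and which lies in all other maximal ideals of R; it is a
   simple root of its characteristic polynomial modulo the maximal ideal, so
   r = s = 1/t works.
   (iv) => (ii): if no power of u were divisible by t in R \ n at some
   embedding, the elements of R infinitely smaller than u at that embedding
   would form a prime ideal containing t but not u.
   (v) => (iv): by prime avoidance, every prime of R comes from a prime of one
   of the d valuation rings of w o s_k, so Spec R is a union of d chains; (v)
   gives an element u_k for each of them, and u is the product of the u_k. *)

(** * Valuation rings *)

Section ValuationRing.
Variables (K : fieldType) (v : valuation K).
Local Notation O := (val_ring v).

Lemma vle_trans (b a c : option (value_group v)) :
  vle a b -> vle b c -> vle a c.
Proof. by case: a b c => [a|] [b|] [c|] //=; apply: le_trans. Qed.

Lemma value_group_leD2l (c a b : value_group v) : (c + a <= c + b) = (a <= b).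
Proof.
apply/idP/idP => [|/(value_group_leD c) //].
by move=> /(value_group_leD (- c)); rewrite !addKr.
Qed.

(** A totally ordered group has no 2-torsion; this is applied to v(-1), twice which is v(1) = 0. *)
Lemma value_group_dbl0 (a : value_group v) : a + a = 0 -> a = 0.
Proof.
move=> a2; apply/eqP; rewrite eq_le.
case/orP: (value_group_total (v := v) 0 a) => h; rewrite h ?andbT //=;
  by have := h; rewrite -(value_group_leD2l a) a2 addr0.
Qed.

Lemma val_zero : v 0 = None.
Proof. by case: (val_eq_infty v 0) => _; apply. Qed.

Lemma val_neq0 x : x != 0 -> exists a, v x = Some a.
Proof.
move=> x0; case e: (v x) => [a|]; first by exists a.
by case/eqP: x0; case: (val_eq_infty v x) => h _; apply: h.
Qed.

Lemma val_one : v 1 = Some 0.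
Proof.
have [a e] := val_neq0 (oner_neq0 K).
have := Defs.valM v 1 1; rewrite mulr1 e /= => -[/eqP].
by rewrite eq_sym -subr_eq0 addrK => /eqP ->.
Qed.

Lemma val_opp x : v (- x) = v x.
Proof.
have [a e] : exists a, v (-1) = Some a by apply: val_neq0; rewrite oppr_eq0 oner_eq0.
have a0 : a = 0.
  apply: value_group_dbl0.
  by have := Defs.valM v (-1) (-1); rewrite mulrNN mulr1 val_one e /= => -[].
by rewrite -mulN1r Defs.valM e a0; case: (v x) => //= b; rewrite add0r.
Qed.

Lemma val_ring1 : O 1.
Proof. by rewrite /val_ring /= val_one. Qed.

Lemma val_ring0 : O 0.
Proof. by rewrite /val_ring /= val_zero. Qed.

Lemma val_ringD x y : O x -> O y -> O (x + y).
Proof.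
move=> hx hy; rewrite /val_ring /=.
by case/orP: (Defs.valD v x y) => [/(vle_trans hx)|/(vle_trans hy)].
Qed.

Lemma val_ringN x : O x -> O (- x).
Proof. by rewrite /val_ring /= val_opp. Qed.

Lemma val_ringM x y : O x -> O y -> O (x * y).
Proof.
rewrite /val_ring /= Defs.valM; case: (v x) (v y) => [a|] [b|] //= ha hb.
by apply: le_trans ha _; rewrite -[X in X <= _]addr0 value_group_leD2l.
Qed.

Lemma val_inv x a : v x = Some a -> v x^-1 = Some (- a).
Proof.
move=> e; have x0 : x != 0 by apply/eqP => x0; rewrite x0 val_zero in e.
have [b eb] : exists b, v x^-1 = Some b by apply: val_neq0; rewrite invr_eq0.
have := Defs.valM v x x^-1; rewrite mulfV // val_one e eb /= => -[ab].
by congr Some; apply/eqP; rewrite -addr_eq0 addrC -ab.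
Qed.

Lemma val_ringV x : O x \/ O x^-1.
Proof.
rewrite /val_ring /=; have [->|/val_neq0[a e]] := eqVneq x 0.
  by rewrite val_zero; left.
rewrite (val_inv e) e /=; case/orP: (value_group_total (v := v) 0 a); first by left.
by move=> h; right; rewrite -(value_group_leD2l a) addr0 subrr.
Qed.

(** With the maximal ideal expressed through inverses, the rest of the section can argue with the
    ring [O] alone. *)
Lemma val_idealE x : val_ideal v x <-> x = 0 \/ ~ O x^-1.
Proof.
rewrite /val_ideal /val_ring /=.
have [->|x0] := eqVneq x 0; first by rewrite val_zero; split=> // _; left.
have [a e] := val_neq0 x0; rewrite (val_inv e) e /=.
rewrite -(value_group_leD2l a 0) addr0 subrr; split=> [/negP h|[/eqP|/negP//]].
  by right.
by rewrite (negPf x0).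
Qed.

Lemma val_ideal_ring x : val_ideal v x -> O x.
Proof.
by move/val_idealE => [->|h]; [exact: val_ring0 | case: (val_ringV x)].
Qed.

Lemma val_ideal0 : val_ideal v 0.
Proof. by apply/val_idealE; left. Qed.

Lemma val_ideal1 : ~ val_ideal v 1.
Proof.
move/val_idealE => [/eqP|]; first by rewrite oner_eq0.
by rewrite invr1; have := val_ring1.
Qed.

Lemma val_unitV x : ~ val_ideal v x -> x != 0 /\ O x^-1.
Proof.
move=> /val_idealE mx; split; first by apply/eqP => x0; apply: mx; left.
by apply: contrapT => h; apply: mx; right.
Qed.

Lemma val_unit x : is_unit_of O x <-> O x /\ ~ val_ideal v x.
Proof.
split=> [[Ox [y Oy xy]]|[Ox /val_unitV[x0 OxV]]].
  have x0 : x != 0 by apply: contra_eq_neq xy => ->; rewrite mul0r eq_sym oner_eq0.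
  split=> // /val_idealE[/eqP|]; first by rewrite (negPf x0).
  by rewrite -[x^-1]mulr1 -xy mulKf.
by split=> //; exists x^-1 => //; rewrite mulfV.
Qed.

Lemma unit_inv x : is_unit_of O x -> x != 0 /\ O x^-1.
Proof. by case/val_unit => _ /val_unitV. Qed.

Lemma unit_mul x y : is_unit_of O x -> is_unit_of O y -> is_unit_of O (x * y).
Proof.
move=> [Ox [x' Ox' xx']] [Oy [y' Oy' yy']]; split; first exact: val_ringM.
by exists (x' * y'); [exact: val_ringM | rewrite mulrACA xx' yy' mulr1].
Qed.

Lemma val_idealM x y : O x -> val_ideal v y -> val_ideal v (x * y).
Proof.
move=> Ox /val_idealE[->|h]; first by rewrite mulr0; exact: val_ideal0.
apply/val_idealE; have [->|x0] := eqVneq x 0; first by left; rewrite mul0r.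
right=> h'; apply: h; have -> : y^-1 = x * (x * y)^-1 by rewrite invfM mulVKf.
exact: val_ringM.
Qed.

Lemma val_idealD x y : val_ideal v x -> val_ideal v y -> val_ideal v (x + y).
Proof.
(* The summand [b] of smaller value is factored out; the cofactor a/b + 1 lies in [O]. *)
have wlog_ a b : O (a / b) -> b != 0 -> val_ideal v b -> val_ideal v (a + b).
  move=> h b0 mb; rewrite -[a](divfK b0) -[X in _ + X]mul1r -mulrDl.
  by apply: val_idealM mb; apply: val_ringD => //; exact: val_ring1.
have [->|x0] := eqVneq x 0; first by rewrite add0r.
have [->|y0] := eqVneq y 0; first by rewrite addr0.
move=> mx my; case: (val_ringV (x / y)) => h; first exact: wlog_.
by rewrite addrC; apply: wlog_ => //; rewrite invfM invrK mulrC in h.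
Qed.

Lemma val_ideal_mulN x y :
  ~ val_ideal v x -> ~ val_ideal v y -> ~ val_ideal v (x * y).
Proof.
move=> /val_unitV[x0 xV] /val_unitV[y0 yV] /val_idealE[/eqP|].
  by rewrite mulf_eq0 (negPf x0) (negPf y0).
by rewrite invfM; apply; exact: val_ringM.
Qed.

Lemma val_ideal_prime x y :
  val_ideal v (x * y) -> val_ideal v x \/ val_ideal v y.
Proof.
move=> mxy; apply: contrapT => h.
by apply: (@val_ideal_mulN x y) mxy => ?; apply: h; [left | right].
Qed.

End ValuationRing.

Lemma val_extends_ring (F K : fieldType) (j : F -> K) (v : valuation F)
  (w : valuation K) : val_extends j v w ->
  forall x, val_ring w (j x) <-> val_ring v x.
Proof.
move=> [e [me h]] x; rewrite /val_ring /= h; case: (v x) => [a|] //=.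
by rewrite -[X in X <= e a](raddf0 e) me.
Qed.

(** * Conjugates *)

(** Roots are split off one at a time. The cofactor stays separable and does not vanish at the root
    removed, so the roots are distinct. *)
Lemma separable_split (L K : fieldType) (i : L -> K) (q : {poly K}) :
  separable_closure i -> separable_poly q ->
  exists2 rs : seq K, uniq rs & q = lead_coef q *: \prod_(x <- rs) ('X - x%:P).
Proof.
move=> [_ Kroots]; have [n le_qn] := ubnP (size q).
elim: n q le_qn => // n IHn q le_qn sep_q.
have [le_q1|lt_1q] := leqP (size q) 1.
  exists [::] => //; rewrite big_nil (size1_polyC le_q1) lead_coefC.
  by rewrite -mul_polyC mulr1.
have [x /factor_theorem[p q_p]] := Kroots q sep_q lt_1q.
have q0 : q != 0 by apply: separable_poly_neq0.
have p0 : p != 0 by apply: contra_neq q0 => p0; rewrite q_p p0 mul0r.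
move: (sep_q); rewrite q_p separable_root => /andP[sep_p px].
have [|rs Urs p_rs] := IHn p _ sep_p.
  by rewrite -ltnS (leq_trans _ le_qn) // q_p size_Mmonic ?monicXsubC // size_XsubC addn2.
exists (rcons rs x).
  rewrite rcons_uniq Urs andbT; apply: contra px => x_rs.
  by rewrite p_rs rootZ ?lead_coef_eq0 // root_prod_XsubC.
rewrite lead_coef_Mmonic ?monicXsubC // -cats1 big_cat big_seq1 /=.
by rewrite scalerAl -p_rs.
Qed.

(** F is the ring of polynomials over L modulo the minimal polynomial of eta, so evaluation at any
    root of the latter is well defined on F. *)
Lemma embedding_of_root (L K : fieldType) (F : fieldExtType L)
    (j : {rmorphism F -> K}) (eta : F) (theta : K) :
  <<1; eta>>%VS = fullv -> root (map_poly j (minPoly 1 eta)) theta ->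
  exists s : {rmorphism F -> K}, forall q, q \is a polyOver 1%VS ->
    s q.[eta] = (map_poly j q).[theta].
Proof.
move=> gen_eta root_theta.
pose s x := (map_poly j (Fadjoin_poly 1 eta x)).[theta].
have poly_of x : exists2 q, q \is a polyOver 1%VS & x = q.[eta].
  exists (Fadjoin_poly 1 eta x); first exact: Fadjoin_polyOver.
  by rewrite (@Fadjoin_poly_eq _ _ 1%AS) // gen_eta memvf.
have sE q : q \is a polyOver 1%VS -> s q.[eta] = (map_poly j q).[theta].
  move=> q1; rewrite /s (@Fadjoin_poly_mod _ _ 1%AS) //.
  rewrite [in RHS](divp_eq q (minPoly 1 eta)) rmorphD rmorphM /= hornerD hornerM.
  by rewrite (eqP root_theta) mulr0 add0r.
have sB : zmod_morphism s.
  move=> x y; have [p p1 ->] := poly_of x; have [q q1 ->] := poly_of y.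
  by rewrite -hornerN -hornerD !sE ?rpredB // rmorphB /= hornerD hornerN.
have sM : monoid_morphism s.
  split=> [|x y].
    by rewrite -(hornerC 1 eta) sE ?rpred1 // rmorph1 hornerC.
  have [p p1 ->] := poly_of x; have [q q1 ->] := poly_of y.
  by rewrite -hornerM !sE ?rpredM // rmorphM /= hornerM.
pose sR : {rmorphism F -> K} := HB.pack s
  (GRing.isZmodMorphism.Build _ _ s sB) (GRing.isMonoidMorphism.Build _ _ s sM).
by exists sR.
Qed.

Lemma conjugate_embeddings (L K : fieldType) (F : fieldExtType L)
    (j : {rmorphism F -> K}) (eta : F) :
  separable_closure (j \o in_alg F) -> <<1; eta>>%VS = fullv ->
  (minPoly 1 eta)^`().[eta] != 0 ->
  exists (n : nat) (s : 'I_n -> {rmorphism F -> K}),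
    [/\ forall k a, s k a%:A = j a%:A,
        injective (fun k => s k eta),
        exists k, s k =1 j &
        map_poly j (minPoly 1 eta) = \prod_k ('X - (s k eta)%:P)].
Proof.
move=> sepK gen_eta h'eta.
(* An irreducible polynomial is separable once its derivative is not zero. *)
have sep_h : separable_poly (minPoly 1 eta).
  have := @separable_nz_der _ _ 1%AS eta; rewrite /separable_element => ->.
  by apply: contra_neq h'eta => ->; rewrite horner0.
have := sep_h; rewrite -(separable_map j) => /(separable_split sepK)[rs Urs].
rewrite lead_coef_map (monicP (monic_minPoly _ _)) rmorph1 scale1r => h_rs.
have root_rs (k : 'I_(size rs)) : root (map_poly j (minPoly 1 eta)) rs`_k.
  by rewrite h_rs root_prod_XsubC mem_nth.
pose s k := sval (cid (embedding_of_root gen_eta (root_rs k))).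
have sE k q : q \is a polyOver 1%VS -> s k q.[eta] = (map_poly j q).[rs`_k].
  exact: (svalP (cid (embedding_of_root gen_eta (root_rs k)))).
have s_eta k : s k eta = rs`_k.
  by rewrite -[in LHS](hornerX eta) sE ?polyOverX // map_polyX hornerX.
exists (size rs), s; split.
- move=> k a; rewrite -[in LHS](hornerC a%:A eta) sE ?map_polyC ?hornerC //.
  by rewrite polyOverC rpredZ // mem1v.
- by move=> k l /eqP; rewrite !s_eta nth_uniq // => /eqP/val_inj.
- have : j eta \in rs.
    by rewrite -root_prod_XsubC -h_rs /root horner_map (eqP (root_minPoly _ _)) rmorph0.
  rewrite -index_mem => lt_k; exists (Ordinal lt_k) => x.
  rewrite -(@Fadjoin_poly_eq _ _ 1%AS eta x) ?gen_eta ?memvf //.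
  rewrite sE ?Fadjoin_polyOver // nth_index -?index_mem //.
  by rewrite horner_map.
- rewrite h_rs (big_nth 0) big_mkord; apply: eq_bigr => k _; by rewrite s_eta.
Qed.

(** [chi] is the characteristic polynomial of multiplication by x: the Vandermonde matrix of the
    conjugates of eta diagonalizes it, with eigenvalues [s k x]. *)
Lemma char_poly_embeddings (L K : fieldType) (F : fieldExtType L)
    (j : {rmorphism F -> K}) (eta : F) (n : nat) (s : 'I_n -> {rmorphism F -> K}) :
  <<1; eta>>%VS = fullv ->
  (forall k a, s k a%:A = j a%:A) -> injective (fun k => s k eta) ->
  map_poly j (minPoly 1 eta) = \prod_k ('X - (s k eta)%:P) ->
  forall x, exists2 chi, chi \is a polyOver 1%VS &
    map_poly j chi = \prod_k ('X - (s k x)%:P).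
Proof.
move=> gen_eta sj s_inj h_roots x.
have [h h_eta] := polyOver1P (minPolyOver 1 eta).
have [q q_x] : exists q, x = (map_poly (in_alg F) q).[eta].
  have [q q_x] := polyOver1P (Fadjoin_polyOver 1 eta x).
  by exists q; rewrite -q_x (@Fadjoin_poly_eq _ _ 1%AS) // gen_eta memvf.
pose f : {rmorphism L -> K} := j \o in_alg F.
have fE p : map_poly j (map_poly (in_alg F) p) = map_poly f p by rewrite map_poly_comp.
have sfE k p : s k (map_poly (in_alg F) p).[eta] = (map_poly f p).[s k eta].
  rewrite -horner_map -map_poly_comp; congr _.[_].
  by apply: eq_map_poly => a; rewrite /= sj.
have size_h : size h = n.+1.
  rewrite -(size_map_poly f) -fE -h_eta h_roots -big_enum /=.
  by rewrite size_prod_XsubC -cardE card_ord.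
have h0 : h != 0 by rewrite -size_poly_gt0 size_h.
have h_root k : (map_poly f h).[s k eta] = 0.
  apply/eqP; rewrite -/(root _ _) -fE -h_eta h_roots.
  by rewrite (bigD1 k) // rootM root_XsubC eqxx.
(* Multiplication by x in the basis of powers of eta: row i holds the coefficients of [q * 'X^i]
   reduced modulo [h]. *)
pose M : 'M[L]_n := \matrix_(i, l) ((q * 'X^i) %% h)`_l.
pose V : 'M[K]_n := Vandermonde n (\row_k s k eta).
have MV : map_mx f M *m V = V *m diag_mx (\row_k s k x).
  apply/matrixP => i k; rewrite mul_mx_diag !mxE.
  have -> : \sum_l map_mx f M i l * V l k = (map_poly f ((q * 'X^i) %% h)).[s k eta].
    rewrite (@horner_coef_wide _ n); last first.
      by rewrite size_map_poly -ltnS -size_h ltn_modp.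
    by apply: eq_bigr => l _; rewrite !mxE coef_map.
  have := congr1 (fun p => (map_poly f p).[s k eta]) (divp_eq (q * 'X^i) h).
  rewrite rmorphD !rmorphM /= hornerD !hornerM h_root mulr0 add0r => <-.
  by rewrite map_polyXn hornerXn -sfE -q_x mulrC.
(* The conjugates of eta are distinct, so this determinant can be cancelled below. *)
have detV : \det V != 0.
  rewrite det_Vandermonde; apply/prodf_neq0 => a _; apply/prodf_neq0 => b ltab.
  rewrite !mxE subr_eq0; apply: contraTneq ltab => /s_inj->; by rewrite ltnn.
exists (map_poly (in_alg F) (char_poly M)).
  by apply/polyOver1P; exists (char_poly M).
rewrite fE map_char_poly; apply: (@mulIf _ (\det V)%:P); first by rewrite polyC_eq0.
rewrite -[(\det V)%:P](det_map_mx (@polyC K)) /char_poly -det_mulmx.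
rewrite [LHS](_ : _ = \det (map_mx polyC V *m diag_mx (\row_k ('X - (s k x)%:P)))).
  by rewrite det_mulmx det_diag mulrC; congr (_ * _); apply: eq_bigr => k _; rewrite mxE.
congr (\det _); rewrite /char_poly_mx mulmxBl mul_scalar_mx -map_mxM MV map_mxM.
have -> : diag_mx (\row_k ('X - (s k x)%:P)) = 'X%:M - map_mx polyC (diag_mx (\row_k (s k x))).
  by apply/matrixP => a b; rewrite !mxE; case: eqP => // _; rewrite ?subrr // subr0.
by rewrite mulmxBr mul_mx_scalar.
Qed.

(** * Subrings and integrality *)

Section SubringOfSet.
Variables (K : fieldType) (B : set K).
Hypothesis subringB : GRing.subring_closed (mem B).

Lemma subring_one : B 1.
Proof. by case: subringB => /set_mem. Qed.

Lemma subring_sub x y : B x -> B y -> B (x - y).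
Proof. by case: subringB => _ h _ /mem_set Bx /mem_set By; apply/set_mem/h. Qed.

Lemma subring_mul x y : B x -> B y -> B (x * y).
Proof. by case: subringB => _ _ h /mem_set Bx /mem_set By; apply/set_mem/h. Qed.

Lemma subring_zero : B 0.
Proof. by rewrite -(subrr 1); apply: subring_sub; apply: subring_one. Qed.

Lemma subring_opp x : B x -> B (- x).
Proof. by rewrite -sub0r; apply: subring_sub; apply: subring_zero. Qed.

Lemma subring_add x y : B x -> B y -> B (x + y).
Proof. by move=> Bx By; rewrite -[y]opprK; apply/subring_sub/subring_opp. Qed.

Lemma subring_exp x m : B x -> B (x ^+ m).
Proof.
by move=> Bx; elim: m => [|m IHm]; [exact: subring_one | rewrite exprS; exact: subring_mul].
Qed.

Lemma subring_prod (I : Type) (r : seq I) (P : pred I) (f : I -> K) :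
  (forall i, P i -> B (f i)) -> B (\prod_(i <- r | P i) f i).
Proof. by move=> Bf; apply: big_ind => //; [exact: subring_one | exact: subring_mul]. Qed.

Lemma subring_horner (p : {poly K}) x :
  (forall i, B p`_i) -> B x -> B p.[x].
Proof.
move=> Bp Bx; rewrite horner_coef; apply: (big_ind B) => [||i _].
- exact: subring_zero.
- exact: subring_add.
- by apply: subring_mul => //; apply: subring_exp.
Qed.

End SubringOfSet.

Lemma subring_set (K : fieldType) (B : set K) :
  B 1 -> (forall x y, B x -> B y -> B (x - y)) ->
  (forall x y, B x -> B y -> B (x * y)) -> GRing.subring_closed (mem B).
Proof.
move=> B1 BB BM; split; first exact: mem_set.
  by move=> x y /set_mem Bx /set_mem By; apply/mem_set/BB.
by move=> x y /set_mem Bx /set_mem By; apply/mem_set/BM.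
Qed.

Section RingAdjoin.
Variables (K : fieldType) (A S : set K).

Lemma ring_adjoin_subring : GRing.subring_closed (mem (ring_adjoin A S)).
Proof.
apply: subring_set => [B [sB _]|x y hx hy B hB|x y hx hy B hB].
- exact: subring_one.
- by apply: (subring_sub hB.1); [apply: hx | apply: hy].
- by apply: (subring_mul hB.1); [apply: hx | apply: hy].
Qed.

Lemma ring_adjoin_base : A `<=` ring_adjoin A S.
Proof. by move=> x Ax B [_ h]; apply: h; left. Qed.

Lemma ring_adjoin_gen : S `<=` ring_adjoin A S.
Proof. by move=> x Sx B [_ h]; apply: h; right. Qed.

Lemma ring_adjoin_min (B : set K) : GRing.subring_closed (mem B) ->
  A `<=` B -> S `<=` B -> ring_adjoin A S `<=` B.
Proof.
by move=> sB AB SB x; apply; split=> // y [/AB|/SB].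
Qed.

End RingAdjoin.

(* Boolean versions of val_ring and base_val_ring, to carry the closure
   instances under which polyOver is available. *)
Definition val_pred (K : fieldType) (v : valuation K) : {pred K} :=
  [pred x | vle (Some 0) (v x)].

Lemma val_pred_subring (K : fieldType) (v : valuation K) :
  GRing.subring_closed (val_pred v).
Proof.
split=> [|x y Ox Oy|x y Ox Oy]; first exact: val_ring1.
  by apply: val_ringD => //; apply: val_ringN.
exact: val_ringM.
Qed.
HB.instance Definition _ (K : fieldType) (v : valuation K) :=
  GRing.isSubringClosed.Build K (val_pred v) (val_pred_subring v).

Definition base_pred (L : fieldType) (F : fieldExtType L) (v : valuation F) :
  {pred F} := [pred x | (x \in val_pred v) && (x \in 1%VS)].

Lemma base_predP (L : fieldType) (F : fieldExtType L) (v : valuation F) x :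
  reflect (base_val_ring v x) (x \in base_pred v).
Proof. exact: andP. Qed.

Lemma base_pred_subring (L : fieldType) (F : fieldExtType L) (v : valuation F) :
  GRing.subring_closed (base_pred v).
Proof.
split=> [|x y /andP[Ox x1] /andP[Oy y1]|x y /andP[Ox x1] /andP[Oy y1]].
- by rewrite inE rpred1 mem1v.
- by rewrite inE !rpredB.
- by rewrite inE !rpredM.
Qed.
HB.instance Definition _ (L : fieldType) (F : fieldExtType L) (v : valuation F) :=
  GRing.isSubringClosed.Build F (base_pred v) (base_pred_subring v).

Lemma polyOver_base (L : fieldType) (F : fieldExtType L) (v : valuation F)
  (p : {poly F}) :
  (p \is a polyOver (mem (base_val_ring v))) = (p \is a polyOver (base_pred v)).
Proof.
by apply: eq_all => x; apply/idP/idP => [/set_mem/base_predP|/base_predP/mem_set].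
Qed.

Lemma val_ring_subring (K : fieldType) (v : valuation K) :
  GRing.subring_closed (mem (val_ring v)).
Proof.
apply: subring_set => [|x y Ox Oy|]; [exact: val_ring1 | | exact: val_ringM].
by apply: val_ringD => //; apply: val_ringN.
Qed.

(** No exponent exceeds m, so the quotient is a polynomial in 1/x over the valuation ring. *)
Lemma horner_div_exp (K : fieldType) (v : valuation K) (p : {poly K}) x m :
  p \is a polyOver (val_pred v) -> (size p <= m.+1)%N -> x != 0 ->
  val_ring v x^-1 -> val_ring v (p.[x] / x ^+ m).
Proof.
move=> Op size_p x0 OxV; rewrite (horner_coef_wide _ size_p) mulr_suml.
apply: (@rpred_sum _ (val_pred v)) => i _; rewrite -mulrA.
apply: (@rpredM _ (val_pred v)); first exact: (polyOverP Op).
have le_im : (i <= m)%N by rewrite -ltnS.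
have -> : x ^+ i / x ^+ m = x^-1 ^+ (m - i).
  move: (nat_of_ord i) le_im => l le_lm.
  by rewrite -{1}(subnKC le_lm) exprD invfM mulrA mulfV ?expf_neq0 // mul1r exprVn.
exact: (@rpredX _ (val_pred v)).
Qed.

(** Valuation rings are integrally closed: if 1/x is in the ring, dividing the equation by a power
    of x writes x as a polynomial in 1/x. *)
Lemma val_ring_integral (K : fieldType) (v : valuation K) (p : {poly K}) x :
  p \is monic -> p \is a polyOver (val_pred v) -> root p x -> val_ring v x.
Proof.
move=> mon_p Op px0; case: (val_ringV v x) => // OxV.
have [->|x0] := eqVneq x 0; first exact: val_ring0.
case size_p: (size p) => [|[|m]].
- by move/monic_neq0: mon_p; rewrite -size_poly_eq0 size_p.
- move/eqP/size_poly1P: size_p px0 => [c c0 ->]; by rewrite rootC (negPf c0).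
(* The degree is m + 1, so dividing by [x ^+ m] isolates x. *)
have -> : x = - ((take_poly m.+1 p).[x] / x ^+ m).
  have := poly_take_drop m.+1 p.
  have -> : drop_poly m.+1 p = 1.
    apply/polyP => i; rewrite coef_drop_poly coef1.
    case: i => [|i] /=.
      by have := monicP mon_p; rewrite lead_coefE size_p /= add0n.
    by rewrite nth_default // size_p addSnnS leq_addl.
  rewrite mul1r => /(congr1 (fun q => q.[x])).
  rewrite hornerD hornerXn (eqP px0) => /eqP; rewrite addr_eq0 => /eqP->.
  by rewrite mulNr opprK exprSr mulrC mulKf // expf_neq0.
apply: val_ringN; apply: horner_div_exp => //; last exact: size_take_poly.
by apply/polyOverP => i; rewrite coef_take_poly; case: ifP => _; rewrite ?rpred0 ?(polyOverP Op).
Qed.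

(** Serves inductions on the degree of an integral equation, and later isolates a norm as constant
    coefficient. *)
Lemma monic_polyOver_recl (R : comNzRingType) (S : addrClosed R) (p : {poly R}) :
  p \is monic -> p \is a polyOver S -> (1 < size p)%N ->
  exists q c, [/\ q \is monic, q \is a polyOver S, c \in S,
                  p = q * 'X + c%:P & (size q).+1 = size p].
Proof.
move=> mon_p Sp; elim/poly_ind: p mon_p Sp => [|p c _]; first by rewrite size_poly0.
rewrite size_MXaddC; have [->|p0] := eqVneq p 0.
  by case: ifP => //=; rewrite size_poly0.
rewrite /= => mon_p Sp size_p; exists p, c; split=> //.
- rewrite monicE -(monicP mon_p) lead_coefDl ?lead_coefMX //.
  by rewrite size_polyC size_mulX // ltnS (leq_trans (leq_b1 _)) ?size_poly_gt0.
- by apply/polyOverP => i; have := polyOverP Sp i.+1; rewrite coefD coefMX coefC addr0.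
- by have := polyOverP Sp 0%N; rewrite coefD coefMX coefC add0r.
Qed.

Lemma horner_deriv_prod_XsubC (K : fieldType) n (c : 'I_n -> K) k :
  (\prod_l ('X - (c l)%:P))^`().[c k] = \prod_(l | l != k) (c k - c l).
Proof.
rewrite (bigD1 k) //= derivM derivXsubC mul1r hornerD hornerM hornerXsubC subrr.
by rewrite mul0r addr0 horner_prod; apply: eq_bigr => l _; rewrite hornerXsubC.
Qed.

(** * Prime ideals *)

Section PrimeIdeals.
Variables (K : fieldType) (B : set K).
Hypothesis subringB : GRing.subring_closed (mem B).

Lemma prime_idealN P x : prime_ideal_of B P -> P x -> P (- x).
Proof.
move=> pP Px; rewrite -mulN1r; apply: (prime_idealM pP) => //.
exact/(subring_opp subringB)/(subring_one subringB).
Qed.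

Lemma prime_idealB P x y : prime_ideal_of B P -> P x -> P y -> P (x - y).
Proof. by move=> pP Px Py; apply: (prime_idealD pP) => //; apply: prime_idealN. Qed.

Lemma prime_ideal_exp P x m : prime_ideal_of B P -> B x -> P (x ^+ m) -> P x.
Proof.
move=> pP Bx; elim: m => [|m IHm]; first by move/(prime_ideal_proper pP).
by rewrite exprS => /(prime_ideal_prime pP Bx (subring_exp subringB m Bx))[|/IHm].
Qed.

Lemma prime_ideal_prod (I : Type) (r : seq I) (P : set K) (f : I -> K) :
  prime_ideal_of B P -> (forall i, B (f i)) -> (forall i, ~ P (f i)) ->
  ~ P (\prod_(i <- r) f i).
Proof.
move=> pP Bf Pf; elim: r => [|i r IHr].
  by rewrite big_nil; apply: (prime_ideal_proper pP).
have Bprod : B (\prod_(i <- r) f i) by apply: (subring_prod subringB).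
by rewrite big_cons => /(prime_ideal_prime pP (Bf i) Bprod)[/Pf|/IHr].
Qed.

Lemma prime_ideal_mulr P x y : prime_ideal_of B P -> B y -> P x -> P (x * y).
Proof. by move=> pP By Px; rewrite mulrC; apply: (prime_idealM pP). Qed.

(** By induction some [y2] in p avoids all the primes except possibly [P k]. If it lies in [P k], it
    is corrected by an element of p that is outside [P k] but inside every [P i] not contained in
    [P k]. *)
Lemma prime_avoidance (I : eqType) (r : seq I) (P : I -> set K) (p : set K) :
  prime_ideal_of B p -> (forall i, prime_ideal_of B (P i)) ->
  (forall i, i \in r -> ~ p `<=` P i) ->
  exists2 y, p y & forall i, i \in r -> ~ P i y.
Proof.
move=> pp pP; elim: r => [|k r IHr] np; first by exists 0 => //; apply: prime_ideal0 pp.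
have [|y2 py2 ny2] := IHr; first by move=> i ir; apply: np; rewrite inE ir orbT.
have [Pky2|nPky2] := pselect (P k y2); last first.
  by exists y2 => // i; rewrite inE => /predU1P[-> //|/ny2].
have [y1 py1 nPky1] : exists2 y1, p y1 & ~ P k y1.
  apply: contrapT => h; apply: (np k); first exact: mem_head.
  by move=> y py; apply: contrapT => nPy; apply: h; exists y.
(* When [P i] is contained in [P k] the factor is 1, as avoiding [P k] then suffices. *)
have sep i : exists f, [/\ B f, ~ P k f & ~ P i f -> P i `<=` P k].
  have [le|nle] := pselect (P i `<=` P k).
    by exists 1; split=> //; [exact: (subring_one subringB) | exact: prime_ideal_proper (pP k)].
  have [f Pif nPkf] : exists2 f, P i f & ~ P k f.
    apply: contrapT => h; apply: nle => f Pif.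
    by apply: contrapT => nPkf; apply: h; exists f.
  by exists f; split=> //; apply: (prime_ideal_sub (pP i)).
pose f i := sval (cid (sep i)).
have fP i : [/\ B (f i), ~ P k (f i) & ~ P i (f i) -> P i `<=` P k].
  exact: (svalP (cid (sep i))).
have Bf i : B (f i) by case: (fP i).
have Bprod r' : B (\prod_(i <- r') f i) by apply: (subring_prod subringB).
have By y : p y -> B y by apply: prime_ideal_sub.
pose z := y1 * \prod_(i <- r) f i.
have nPkz : ~ P k (y2 + z).
  move=> /(prime_idealB (pP k))/(_ Pky2); rewrite addrC addKr => Pkz.
  case: (prime_ideal_prime (pP k) _ _ Pkz) => //; first exact: By.
  by apply: prime_ideal_prod => // i; case: (fP i).
exists (y2 + z).
  by apply: (prime_idealD pp) => //; apply: (prime_ideal_mulr pp).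
move=> i; rewrite inE => /predU1P[->//|ir] Piyz.
have [_ _ fi] := fP i.
have [Pif|/fi le] := pselect (P i (f i)); last exact/nPkz/le.
apply: (ny2 i ir); rewrite -(addrK z y2); apply: (prime_idealB (pP i)) => //.
rewrite /z; elim: (r) ir => // l r' IHr'; rewrite inE big_cons => /predU1P[<-|/IHr' Pr'].
  rewrite mulrCA; apply: (prime_ideal_mulr (pP i)) => //.
  by apply: (subring_mul subringB) => //; exact: By.
by rewrite mulrCA; apply: (prime_idealM (pP i)).
Qed.

Variable (S : subringClosed K).
Hypothesis SB : forall x, x \in S -> B x.

(** Incomparability in integral extensions. The constant coefficient c of f lies in P, hence in p,
    so p contains q(x) x; either x is in p, or q, of smaller degree, replaces f. *)
Lemma integral_incomparable p P x f :
  prime_ideal_of B p -> prime_ideal_of B P -> p `<=` P ->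
  (forall a, a \in S -> P a -> p a) ->
  f \is monic -> f \is a polyOver S -> p f.[x] -> P x -> p x.
Proof.
move=> pp pP sub_pP Sp mon_f Sf pfx Px.
have Bx : B x by apply: prime_ideal_sub pP _ Px.
have [m] := ubnP (size f); elim: m => // m IHm in f mon_f Sf pfx *.
have [le_f1|lt_1f] := leqP (size f) 1.
  move: pfx; rewrite (size1_polyC le_f1) hornerC -[f`_0]/(f`_(1.-1)).
  have -> : 1%N = size f.
    by apply/eqP; rewrite eq_sym eqn_leq le_f1 size_poly_gt0 monic_neq0.
  by rewrite -/(lead_coef f) (monicP mon_f) => /(prime_ideal_proper pp).
have [q [c [mon_q Sq Sc fE size_q]]] := monic_polyOver_recl mon_f Sf lt_1f.
rewrite -size_q ltnS => lt_qm.
have Bq : B q.[x] by apply: (subring_horner subringB) => // i; apply/SB/(polyOverP Sq).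
move: pfx; rewrite fE hornerMXaddC => pqc.
have pc : p c.
  apply: Sp => //; rewrite -(addKr (q.[x] * x) c) addrC.
  by apply: (prime_idealB pP) => //; [apply: sub_pP | apply: (prime_idealM pP)].
have pqx : p (q.[x] * x) by rewrite -(addrK c (q.[x] * x)); apply: (prime_idealB pp).
by case: (prime_ideal_prime pp Bq Bx pqx) => // pq; apply: (IHm q).
Qed.

(** The integral equation of b/t is multiplied by [t ^+ m], with m the degree of f; every term but
    [b ^+ m] keeps a factor t. *)
Lemma integral_divides b t f :
  B b -> B t -> t != 0 -> f \is monic -> f \is a polyOver S -> root f (b / t) ->
  exists m a, B a /\ b ^+ m = t * a.
Proof.
move=> Bb Bt t0 mon_f Sf root_f; pose m := (size f).-1.
have size_f : size f = m.+1 by rewrite prednK // size_poly_gt0 monic_neq0.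
have fE : f.[b / t] * t ^+ m = b ^+ m + \sum_(i < m) f`_i * b ^+ i * t ^+ (m - i).
  rewrite horner_coef size_f big_ord_recr /= mulrDl addrC; congr (_ + _).
    have -> : f`_m = 1 by apply/monicP.
    by rewrite mul1r expr_div_n divfK // expf_neq0.
  rewrite mulr_suml; apply: eq_bigr => i _; rewrite -!mulrA; congr (_ * _).
  rewrite expr_div_n -mulrA; congr (_ * _).
  move: (nat_of_ord i) (ltnW (ltn_ord i)) => l le_lm.
  by rewrite -{1}(subnKC le_lm) exprD mulKf // expf_neq0.
pose a := \sum_(i < m) f`_i * b ^+ i * t ^+ (m - i).-1.
exists m, (- a); split.
  apply: (subring_opp subringB); apply: (big_ind B) => [||i _].
  - exact: (subring_zero subringB).
  - exact: (subring_add subringB).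
  - apply: (subring_mul subringB); last exact: (subring_exp subringB).
    apply: (subring_mul subringB); last exact: (subring_exp subringB).
    exact/SB/(polyOverP Sf).
move: fE; rewrite (eqP root_f) mul0r => /esym/eqP; rewrite addr_eq0 => /eqP->.
rewrite mulrN mulr_sumr; congr (- _); apply: eq_bigr => i _.
by rewrite mulrCA -exprS prednK // subn_gt0.
Qed.

End PrimeIdeals.

(** [g] is the reciprocal polynomial X^m f(1/X). If f(b) = 0, then g'(1/b) is -f'(b) up to a power
    of b, so simple roots stay simple under inversion. *)
Lemma reciprocal_poly (K : fieldType) (f : {poly K}) (b : K) m :
  (size f <= m.+1)%N -> b != 0 ->
  let g := \sum_(i < m.+1) f`_i *: 'X^(m - i) in
  g.[b^-1] * b ^+ m = f.[b] /\
  g^`().[b^-1] * b ^+ m = b * f.[b] *+ m - b ^+ 2 * f^`().[b].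
Proof.
move=> size_f b0 g.
have fE : f = \sum_(i < m.+1) f`_i *: 'X^i.
  rewrite -poly_def; apply/polyP => i; rewrite coef_poly.
  by case: ltnP => // /(leq_trans size_f)/leq_sizeP->.
have bX l : (l <= m)%N -> b^-1 ^+ (m - l) * b ^+ m = b ^+ l.
  move=> le_lm; rewrite -{2}(subnK le_lm) exprD mulrA -exprMn mulVf // expr1n mul1r //.
split.
  rewrite [in RHS]fE /g !horner_sum mulr_suml; apply: eq_bigr => i _.
  by rewrite !hornerZ !hornerXn -mulrA bX // -ltnS.
rewrite [in RHS]fE /g !raddf_sum /= !horner_sum mulr_suml mulr_sumr mulr_sumr -sumrMnl -sumrB.
apply: eq_bigr => i _; rewrite !derivZ !derivXn !hornerZ !hornerMn !hornerXn.
move: (nat_of_ord i) (ltn_ord i) => l; rewrite ltnS => le_lm.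
(* The predecessors in [e1] and [e2] are truncated only where the multiplicity is 0. *)
have e1 : b^-1 ^+ (m - l).-1 *+ (m - l) * b ^+ m = b ^+ l.+1 *+ (m - l).
  have [->|] := eqVneq (m - l)%N 0%N; first by rewrite !mulr0n mul0r.
  rewrite -lt0n mulrnAl => ml; congr (_ *+ _); rewrite -[m in b ^+ m](subnK le_lm).
  by rewrite -{2}(prednK ml) addSnnS exprD mulrA -exprMn mulVf // expr1n mul1r.
have e2 : b ^+ 2 * (b ^+ l.-1 *+ l) = b ^+ l.+1 *+ l.
  by case: (l) => [|l']; rewrite ?mulr0n ?mulr0 // mulrnAr -exprD.
rewrite -mulrA e1 mulrCA -exprS [b ^+ 2 * _]mulrCA e2 -mulrnAr -mulrBr.
by rewrite mulrnBr.
Qed.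

(** * The order generated by eta *)

Section Conjugates.
Variables (L K : fieldType) (F : fieldExtType L).
Variables (v : valuation F) (w : valuation K) (j : {rmorphism F -> K}).
Variables (eta : F) (n : nat) (s : 'I_n -> {rmorphism F -> K}) (k0 : 'I_n).

Local Notation O := (val_ring v).
Local Notation Ow := (val_ring w).
Local Notation mw := (val_ideal w).
Local Notation A := (base_val_ring v).
Local Notation h := (minPoly 1 eta).
Local Notation R := (ring_adjoin A [set eta]).

Hypothesis gen_eta : <<1; eta>>%VS = fullv.
Hypothesis jO : forall x, Ow (j x) <-> O x.
Hypothesis sj : forall k a, s k a%:A = j a%:A.
Hypothesis s_inj : injective (fun k => s k eta).
Hypothesis sk0 : s k0 =1 j.
Hypothesis h_roots : map_poly j h = \prod_k ('X - (s k eta)%:P).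
Hypothesis hA : h \is a polyOver (base_pred v).
Hypothesis eta_unit : is_unit_of O eta.
Hypothesis h'_unit : is_unit_of O h^`().[eta].

Let subR := ring_adjoin_subring A [set eta].
Let subO := val_ring_subring v.
Let subOw := val_ring_subring w.

(** * Conjugates of elements of the order and their characteristic polynomials *)

Lemma conj_ideal x : mw (j x) <-> val_ideal v x.
Proof.
rewrite !val_idealE -fmorphV jO; split=> -[x0|]; [left| by right| |by right].
  by apply/eqP; rewrite -(fmorph_eq0 j) x0.
by left; rewrite x0 rmorph0.
Qed.

Lemma conj_base k a : a \in 1%VS -> s k a = j a.
Proof. by case/vlineP => c ->; apply: sj. Qed.

Lemma conj_map k p : p \is a polyOver 1%VS -> map_poly (s k) p = map_poly j p.
Proof.
by move=> p1; apply/polyP => i; rewrite !coef_map /= conj_base // (polyOverP p1).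
Qed.

Lemma base_polyOver1 p : p \is a polyOver (base_pred v) -> p \is a polyOver 1%VS.
Proof. by move=> pA; apply/polyOverP => i; case/andP: (polyOverP pA i). Qed.

Lemma base_polyOver_val p : p \is a polyOver (base_pred v) ->
  map_poly j p \is a polyOver (val_pred w).
Proof.
move=> pA; apply/polyOverP => i; rewrite coef_map; apply/jO.
by case/andP: (polyOverP pA i).
Qed.

(** h is monic over O_L, so its roots lie in the integrally closed ring O_w. *)
Lemma conj_eta_val k : Ow (s k eta).
Proof.
have mon_h : map_poly j h \is monic by rewrite map_monic monic_minPoly.
apply: val_ring_integral mon_h (base_polyOver_val hA) _.
by rewrite h_roots (bigD1 k) // rootM root_XsubC eqxx.
Qed.

Lemma conj_order_val k x : R x -> Ow (s k x).
Proof.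
apply: (ring_adjoin_min (B := [set x | Ow (s k x)])) => /=.
- apply: subring_set => [|y z Oy Oz|y z Oy Oz] /=; rewrite ?rmorph1 ?rmorphB ?rmorphM.
  + exact: val_ring1.
  + exact: subring_sub.
  + exact: subring_mul.
- by move=> a [Oa a1] /=; rewrite conj_base //; apply/jO.
- by move=> _ ->; apply: conj_eta_val.
Qed.

Lemma order_sub_val x : R x -> O x.
Proof. by move=> Rx; apply/jO; rewrite -sk0; apply: conj_order_val. Qed.

Lemma order_eta : R eta.
Proof. exact: ring_adjoin_gen. Qed.

(** The coefficients come from L, being those of a characteristic polynomial, and lie in O_w because
    the linear factors are defined over O_w. *)
Lemma conj_char_poly x : (forall k, Ow (s k x)) ->
  exists2 chi, chi \is monic /\ chi \is a polyOver (base_pred v) &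
    map_poly j chi = \prod_k ('X - (s k x)%:P).
Proof.
move=> Ox.
have [chi chi1 chiE] := char_poly_embeddings gen_eta sj s_inj h_roots x.
exists chi => //; split.
  by rewrite -(map_monic j) chiE; apply: monic_prod_XsubC.
apply/polyOverP => i; rewrite inE (polyOverP chi1) andbT; apply/jO.
rewrite -coef_map chiE; apply: (polyOverP (S := val_pred w)); apply: rpred_prod => k _.
by rewrite polyOverXsubC; apply: Ox.
Qed.

Lemma conj_char_root x chi : map_poly j chi = \prod_k ('X - (s k x)%:P) ->
  chi.[x] = 0.
Proof.
move=> chiE; apply/eqP; rewrite -(fmorph_eq0 j) -horner_map chiE.
by rewrite -/(root _ _) (bigD1 k0) // rootM root_XsubC sk0 eqxx.
Qed.

Lemma conj_char_deriv x chi : map_poly j chi = \prod_k ('X - (s k x)%:P) ->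
  j chi^`().[x] = \prod_(k | k != k0) (j x - s k x).
Proof.
move=> chiE; rewrite -horner_map -deriv_map chiE -sk0.
exact: (horner_deriv_prod_XsubC (fun k => s k x)).
Qed.

(* By Lagrange interpolation, x = p(eta) has h'(eta) x = q(eta), where q is the
   sum over k of (s_k x) h / (X - s_k eta). *)
Lemma integral_different x : (forall k, Ow (s k x)) -> R (h^`().[eta] * x).
Proof.
move=> Ox; pose p := Fadjoin_poly 1 eta x.
have p1 : p \is a polyOver 1%VS by apply: Fadjoin_polyOver.
have p_x : p.[eta] = x by rewrite (@Fadjoin_poly_eq _ _ 1%AS) // gen_eta memvf.
pose q := (p * h^`()) %% h.
have h1 := base_polyOver1 hA.
have q1 : q \is a polyOver 1%VS.
  by apply: modp_polyOver => //; rewrite rpredM // polyOver_deriv.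
have q_eta : q.[eta] = h^`().[eta] * x.
  have := congr1 (fun g => g.[eta]) (divp_eq (p * h^`()) h).
  by rewrite hornerD !hornerM (eqP (root_minPoly _ _)) mulr0 add0r p_x mulrC => <-.
pose g := \sum_k s k x *: \prod_(l | l != k) ('X - (s l eta)%:P).
have size_h : size h = n.+1.
  by rewrite -(size_map_poly j) h_roots -big_enum /= size_prod_XsubC -cardE card_ord.
have size_g : (size g <= n)%N.
  apply: (leq_trans (size_sum _ _ _)); apply/bigmax_leqP => k _.
  apply: (leq_trans (size_scale_leq _ _)).
  have := size_map_poly j h; rewrite size_h h_roots (bigD1 k) //=.
  rewrite size_monicM ?monicXsubC //; last first.
    by apply/prodf_neq0 => l _; rewrite polyXsubC_eq0.
  by rewrite size_XsubC add2n => -[->].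
have root_h k : (map_poly j h).[s k eta] = 0.
  by apply/eqP; rewrite -/(root _ _) h_roots (bigD1 k) // rootM root_XsubC eqxx.
have q_g : map_poly j q = g.
  apply/eqP; rewrite -subr_eq0; apply/eqP.
  apply: (@roots_geq_poly_eq0 _ _ [seq s k eta | k <- enum 'I_n]).
  - apply/allP => _ /mapP[k _ ->]; rewrite /root hornerD hornerN subr_eq0.
    have := congr1 (fun f => (map_poly j f).[s k eta]) (divp_eq (p * h^`()) h).
    rewrite rmorphD !rmorphM /= hornerD !hornerM root_h mulr0 add0r => <-.
    rewrite -(conj_map k p1) horner_map p_x -deriv_map h_roots.
    rewrite (horner_deriv_prod_XsubC (fun k => s k eta)) horner_sum [X in _ == X](bigD1 k) //=.
    rewrite hornerZ horner_prod [X in _ + X]big1 ?addr0 => [|l lk].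
      by apply/eqP; congr (_ * _); apply: eq_bigr => l _; rewrite hornerXsubC.
    by rewrite hornerZ horner_prod (bigD1 k) 1?eq_sym //= hornerXsubC subrr mul0r mulr0.
  - by rewrite map_inj_uniq ?enum_uniq.
  - rewrite size_map -cardE card_ord (leq_trans (size_polyD _ _)) // size_polyN geq_max size_g.
    by rewrite size_map_poly -ltnS -size_h ltn_modp -size_poly_gt0 size_h andbT.
rewrite -q_eta; apply: subring_horner order_eta => // i; apply: ring_adjoin_base.
split; last exact: (polyOverP q1).
apply/jO; rewrite -coef_map q_g.
apply: (polyOverP (S := val_pred w)); apply: rpred_sum => k _.
apply: polyOverZ; first exact: Ox.
by apply: rpred_prod => l _; rewrite polyOverXsubC; apply: conj_eta_val.
Qed.

(** The index is the last one of least valuation, described through quotients. A new last term takes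
    over unless its quotient by the former choice lies in the maximal ideal. *)
Lemma val_min_last (c : nat -> F) N : (exists2 i, (i < N)%N & c i != 0) ->
  exists m, [/\ (m < N)%N, c m != 0, forall i, (i < N)%N -> O (c i / c m) &
                forall i, (m < i < N)%N -> val_ideal v (c i / c m)].
Proof.
elim: N => [|N IHN] [i lt_iN ci0] //.
have [[i' lt_i'N ci'0]|c0] := pselect (exists2 i, (i < N)%N & c i != 0); last first.
  have c0' l : (l < N)%N -> c l = 0.
    by move=> ltlN; apply/eqP/negPn/negP => cl; apply: c0; exists l.
  have iN : i = N.
    by move: lt_iN; rewrite ltnS leq_eqVlt => /predU1P[//|/c0' ci]; rewrite ci eqxx in ci0.
  exists N; split=> //; first by rewrite -iN.
    move=> l; rewrite ltnS leq_eqVlt => /predU1P[->|/c0' ->].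
      by rewrite mulfV -?iN //; exact: val_ring1.
    by rewrite mul0r; exact: val_ring0.
  by move=> l; rewrite ltnS; case: ltnP.
have [|m [lt_mN cm0 Om mm]] := IHN; first by exists i'.
have [mN|] := pselect (val_ideal v (c N / c m)).
  exists m; split=> // [|l|l]; first exact: ltnW.
    rewrite ltnS leq_eqVlt => /predU1P[->|/Om //]; exact: val_ideal_ring.
  by rewrite ltnS [(l <= N)%N]leq_eqVlt => /andP[ml /predU1P[-> //|lN]]; apply: mm; rewrite ml.
move=> /val_unitV[cNm0].
rewrite invfM invrK mulrC => OmN.
have cN0 : c N != 0 by apply: contra_neq cNm0 => ->; rewrite mul0r.
exists N; split=> // [l|l]; last by rewrite ltnS; case: ltnP.
rewrite ltnS leq_eqVlt => /predU1P[->|ltlN]; first by rewrite mulfV //; exact: val_ring1.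
by have := val_ringM (Om l ltlN) OmN; rewrite mulrA divfK.
Qed.

(* Scale the minimal polynomial of x so that its last coefficient of least
   valuation is 1, at degree m say, and let u be the value at x of its part of
   degree at least m, divided by x^m. Then u is a unit, and at each embedding u
   and u x are integral: by the upper part if x is, by the lower part if 1/x is. *)
Lemma order_fraction x : O x ->
  exists a u, [/\ R a, R u, is_unit_of O u & x = a / u].
Proof.
move=> Ox; pose f := minPoly 1 x.
have f1 : f \is a polyOver 1%VS by apply: minPolyOver.
have f0 : f != 0 by apply/monic_neq0/monic_minPoly.
have [|m [lt_mf fm0 Of mf]] := @val_min_last (fun i => f`_i) (size f).
  exists (size f).-1; first by rewrite prednK // size_poly_gt0.
  by rewrite -/(lead_coef f) lead_coef_eq0.
pose g := (f`_m)^-1 *: f.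
have g_coef i : g`_i = f`_i / f`_m by rewrite coefZ mulrC.
have gO i : O g`_i.
  rewrite g_coef; have [/Of //|le_fi] := ltnP i (size f).
  by rewrite nth_default // mul0r; exact: val_ring0.
have g_ideal i : (m < i)%N -> val_ideal v g`_i.
  move=> lt_mi; rewrite g_coef; have [lt_if|le_fi] := ltnP i (size f).
    by apply: mf; rewrite lt_mi.
  by rewrite nth_default // mul0r; exact: val_ideal0.
have gA : g \is a polyOver (base_pred v).
  apply/polyOverP => i; rewrite inE; apply/andP; split; first exact: gO.
  by rewrite g_coef; apply: (@rpred_div _ 1%AS); apply: (polyOverP f1).
have dropA i : drop_poly i g \is a polyOver (base_pred v).
  by apply/polyOverP => l; rewrite coef_drop_poly (polyOverP gA).
have takeA i : take_poly i g \is a polyOver (base_pred v).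
  by apply/polyOverP => l; rewrite coef_take_poly; case: ifP; rewrite ?rpred0 ?(polyOverP gA).
pose u := (drop_poly m g).[x].
have conj_u k : s k u = (map_poly j (drop_poly m g)).[s k x].
  by rewrite -(conj_map k (base_polyOver1 (dropA m))) horner_map.
have conj_rel k : s k u * s k x ^+ m = - (map_poly j (take_poly m g)).[s k x].
  have : s k g.[x] = 0 by rewrite hornerZ (eqP (root_minPoly _ _)) mulr0 rmorph0.
  rewrite -[g in g.[x]](poly_take_drop m) hornerD hornerM hornerXn rmorphD rmorphM rmorphXn /=.
  rewrite -(conj_map k (base_polyOver1 (takeA m))) horner_map => /eqP.
  by rewrite addrC addr_eq0 => /eqP.
have conj_int k : Ow (s k u) /\ Ow (s k (u * x)).
  have [Oz|nOz] := pselect (Ow (s k x)).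
    suff Ou : Ow (s k u) by split=> //; rewrite rmorphM; apply: val_ringM.
    rewrite conj_u; apply: subring_horner => // i.
    exact: (polyOverP (base_polyOver_val (dropA m))).
  have z0 : s k x != 0 by apply/eqP => z0; apply: nOz; rewrite z0; exact: val_ring0.
  have OzV : Ow (s k x)^-1 by case: (val_ringV w (s k x)).
  have := conj_rel k; have := base_polyOver_val (takeA m).
  have := size_take_poly m g; rewrite -(size_map_poly j).
  move: (map_poly j _) => t size_t tO rel; rewrite rmorphM.
  have uE : s k u = - (t.[s k x] / s k x ^+ m).
    by apply: (mulIf (expf_neq0 m z0)); rewrite rel -mulNr divfK // expf_neq0.
  split; first by rewrite uE; apply/val_ringN/horner_div_exp => //; apply: leqW.
  (* For m = 0 the lower part vanishes and with it [s k u]; the exponent m - 1 used next needs m >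
     0. *)
  have [m0|m_gt0] := posnP m.
    move: size_t rel; rewrite m0 expr0 mulr1 leqn0 size_poly_eq0 => /eqP-> ->.
    by rewrite horner0 oppr0 mul0r; exact: val_ring0.
  rewrite uE -(prednK m_gt0) exprSr invfM mulNr mulrA divfK //.
  by apply/val_ringN/horner_div_exp => //; rewrite prednK.
have u_unit : is_unit_of O u.
  (* u is congruent to 1: the coefficient of [g] at m is 1, and the later ones are in the maximal
     ideal. *)
  have : val_ideal v (u - 1).
    have -> : u - 1 = (drop_poly m.+1 g).[x] * x.
      rewrite /u; have -> : drop_poly m g = drop_poly m.+1 g * 'X + 1.
        apply/polyP => -[|i]; rewrite coefD coefMX !coef_drop_poly coef1 /=.
          by rewrite add0n add0r g_coef mulfV.
        by rewrite addr0 addSnnS.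
      by rewrite hornerD hornerMX hornerC addrK.
    rewrite mulrC; apply: val_idealM => //; rewrite horner_coef.
    apply: (big_ind (val_ideal v)) => [||i _]; [exact: val_ideal0 | exact: val_idealD |].
    rewrite mulrC; apply: val_idealM; first exact: (subring_exp subO).
    by rewrite coef_drop_poly; apply: g_ideal; rewrite addnS ltnS leq_addl.
  move=> mu; apply/val_unit; split.
    by rewrite -(subrK 1 u); apply: val_ringD; [exact: val_ideal_ring | exact: val_ring1].
  move=> mu'; apply: (@val_ideal1 _ v); rewrite -(subKr u 1) addrC.
  apply: val_idealD => //; rewrite -mulN1r; apply: val_idealM => //.
  by apply: val_ringN; exact: val_ring1.
have [u0 Ou] : u != 0 /\ O u^-1 by apply: val_unitV; case/val_unit: u_unit.
have [d0 Od] : h^`().[eta] != 0 /\ O h^`().[eta]^-1.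
  by apply: val_unitV; case/val_unit: h'_unit.
(* The unit h'(eta) brings numerator and denominator into R, by [integral_different]. *)
exists (h^`().[eta] * (u * x)), (h^`().[eta] * u); split.
- by apply: integral_different => k; case: (conj_int k).
- by apply: integral_different => k; case: (conj_int k).
- split; first by apply: val_ringM; [case: h'_unit | case: u_unit].
  exists (h^`().[eta] * u)^-1; last by rewrite mulfV // mulf_neq0.
  by rewrite invfM; apply: val_ringM.
- by rewrite mulrA mulrC mulKf // mulf_neq0.
Qed.

(** * The prime n and the integrality of R over O_L *)

Local Notation n_ := (val_ideal v `&` R).

Lemma base_order a : a \in base_pred v -> R a.
Proof. by move/base_predP; apply: ring_adjoin_base. Qed.

(** These are the centers on R of the valuations induced by w through the embeddings; n is the
    center at [k0]. *)
Lemma conj_ideal_prime k : prime_ideal_of R [set x | R x /\ mw (s k x)].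
Proof.
split=> [x []||x y [Rx mx] [Ry my]|a x Ra [Rx mx]|[_]|x y Rx Ry [_]] //=.
- by split; [exact: subring_zero subR | rewrite rmorph0; exact: val_ideal0].
- by split; [exact: (subring_add subR) | rewrite rmorphD; exact: val_idealD].
- split; first exact: (subring_mul subR).
  by rewrite rmorphM; apply: val_idealM => //; apply: conj_order_val.
- by rewrite rmorph1; apply: val_ideal1.
- by rewrite rmorphM => /val_ideal_prime[]; [left | right].
Qed.

Lemma center_conj : n_ = [set x | R x /\ mw (s k0 x)].
Proof.
by apply/seteqP; split=> x [] /=; rewrite sk0 conj_ideal.
Qed.

Lemma center_prime : prime_ideal_of R n_.
Proof. by rewrite center_conj; apply: conj_ideal_prime. Qed.

Lemma order_unit x : R x -> ~ n_ x -> is_unit_of O x.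
Proof.
by move=> Rx nx; apply/val_unit; split=> [|mx]; [exact: order_sub_val | exact: nx].
Qed.

Lemma order_conj_int x : R x -> exists2 chi,
  chi \is monic /\ chi \is a polyOver (base_pred v) &
  map_poly j chi = \prod_k ('X - (s k x)%:P).
Proof. by move=> Rx; apply: conj_char_poly => k; apply: conj_order_val. Qed.

Lemma order_incomparable p P :
  prime_ideal_of R p -> prime_ideal_of R P -> p `<=` P ->
  (forall a, a \in base_pred v -> P a -> p a) -> P `<=` p.
Proof.
move=> pp pP sub_pP Ap x Px; have Rx : R x by apply: prime_ideal_sub pP _ Px.
have [chi [mon_chi chiA] chiE] := order_conj_int Rx.
apply: (integral_incomparable subR base_order pp pP sub_pP Ap mon_chi chiA) => //.
by rewrite (conj_char_root chiE); apply: prime_ideal0 pp.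
Qed.

(** An integral equation of y is read modulo n. A constant coefficient that is a unit of O_L gives
    an inverse of y; otherwise y can be cancelled and the degree drops. *)
Lemma center_maximal y : R y -> ~ n_ y -> exists2 t, R t & n_ (y * t - 1).
Proof.
move=> Ry ny; have [f [mon_f fA] /conj_char_root f0] := order_conj_int Ry.
have : n_ f.[y] by rewrite f0; apply: prime_ideal0 center_prime.
have [m] := ubnP (size f); elim: m f mon_f fA {f0} => // m IHm f mon_f fA.
have [le_f1|lt_1f] := leqP (size f) 1.
  have : f`_0 = 1.
    by rewrite -(monicP mon_f) lead_coefE; move: le_f1; case: (size f) => [|[|]].
  rewrite (size1_polyC le_f1) hornerC coefC /= => -> _.
  by move/(prime_ideal_proper center_prime).
have [q [c [mon_q Sq Sc fE size_q]]] := monic_polyOver_recl mon_f fA lt_1f.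
rewrite -size_q ltnS fE hornerMXaddC => lt_qm nqc.
have Rq : R q.[y].
  by apply: (subring_horner subR) => [i|//]; exact: base_order (polyOverP Sq i).
have [nc|nc] := pselect (val_ideal v c).
  have nqy : n_ (q.[y] * y).
    rewrite -(addrK c (q.[y] * y)); apply: (prime_idealB subR center_prime) => //.
    by split=> //; exact: (base_order Sc).
  by case: (prime_ideal_prime center_prime Rq Ry nqy) => // nq; apply: (IHm q).
have [c0 Oc] := val_unitV nc.
have Ac : c^-1 \in base_pred v.
  by rewrite inE; apply/andP; split=> //; rewrite (@rpredV _ 1%AS); case/andP: Sc.
exists (- (c^-1 * q.[y])).
  exact: (subring_opp subR (subring_mul subR (base_order Ac) Rq)).
have -> : y * - (c^-1 * q.[y]) - 1 = - c^-1 * (q.[y] * y + c).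
  by rewrite mulrDr mulrN !mulNr mulVf // [q.[y] * y]mulrC mulrCA.
apply: (prime_idealM center_prime) => //.
exact: (subring_opp subR (base_order Ac)).
Qed.

(** * Inverting one element of the order *)

Lemma adjoin_inv_sub u : R u -> is_unit_of O u ->
  ring_adjoin A [set eta; u^-1] `<=` O.
Proof.
move=> Ru /unit_inv[u0 Ou]; apply: ring_adjoin_min => //.
  by move=> a [].
by move=> x [->|->] //; case: eta_unit.
Qed.

Lemma order_sub_adjoin (S : set F) : S eta -> R `<=` ring_adjoin A S.
Proof.
move=> S_eta; apply: ring_adjoin_min.
- exact: ring_adjoin_subring.
- exact: ring_adjoin_base.
- by move=> _ ->; apply: ring_adjoin_gen.
Qed.

Lemma adjoin_invP u x : u != 0 -> R u ->
  ring_adjoin A [set eta; u^-1] x -> exists a m, R a /\ x = a / u ^+ m.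
Proof.
move=> u0 Ru; pose B := [set x | exists a m, R a /\ x = a / u ^+ m].
apply: (ring_adjoin_min (B := B)).
- apply: subring_set => [|_ _ [a [m [Ra ->]]] [b [l [Rb ->]]]|
                           _ _ [a [m [Ra ->]]] [b [l [Rb ->]]]].
  + by exists 1, 0%N; split; [exact: (subring_one subR) | rewrite expr0 divr1].
  + exists (a * u ^+ l - b * u ^+ m), (m + l)%N; split.
      by apply: (subring_sub subR); apply: (subring_mul subR) => //; apply: (subring_exp subR).
    rewrite exprD mulrBl; congr (_ - _).
      by rewrite -mulf_div divff ?expf_neq0 // mulr1.
    by rewrite [u ^+ m * u ^+ l]mulrC -mulf_div divff ?expf_neq0 // mulr1.
  + exists (a * b), (m + l)%N; split; first exact: (subring_mul subR).
    by rewrite mulf_div exprD.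
- by move=> a Aa; exists a, 0%N; rewrite expr0 divr1; split=> //; apply: ring_adjoin_base.
- move=> _ [->|->]; first by exists eta, 0%N; rewrite expr0 divr1; split=> //; apply: order_eta.
  by exists 1, 1%N; rewrite expr1 div1r; split=> //; apply: (subring_one subR).
Qed.

(** By [order_fraction], each element of O_F has a denominator t in R that is a unit of O_F; once t
    divides a power of u, that power can replace it. *)
Lemma adjoin_inv_eq u : R u -> is_unit_of O u ->
  (forall t, R t -> is_unit_of O t -> exists a m, R a /\ u ^+ m = t * a) ->
  O = ring_adjoin A [set eta; u^-1].
Proof.
move=> Ru u_unit div_u; have u0 : u != 0 by case: (unit_inv u_unit).
apply/seteqP; split; last exact: adjoin_inv_sub.
move=> _ /order_fraction[a [t [Ra Rt t_unit ->]]].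
have t0 : t != 0 by case: (unit_inv t_unit).
have [b [m [Rb um]]] := div_u t Rt t_unit.
have -> : a / t = a * b * u^-1 ^+ m.
  have b0 : b != 0 by apply: contra_neq (expf_neq0 m u0) => b0; rewrite um b0 mulr0.
  by rewrite exprVn um invfM mulrA mulrAC mulfK // mulrC.
have subB := ring_adjoin_subring A [set eta; u^-1].
have RB := @order_sub_adjoin [set eta; u^-1] (or_introl erefl).
apply: (subring_mul subB); first by apply: (subring_mul subB); apply: RB.
by apply: (subring_exp subB); apply: ring_adjoin_gen; right.
Qed.

Lemma fg_adjoin_inv : finitely_generated_algebra A O ->
  exists u, [/\ is_unit_of O u, R u & O = ring_adjoin A [set eta; u^-1]].
Proof.
move=> [S [/finite_seqP[r ->] OE]].
have Or x : x \in r -> O x by move=> xr; rewrite OE; apply: ring_adjoin_gen.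
(* The product of the denominators of the generators is a common denominator. *)
have [u [u_unit Ru ru]] : exists u, [/\ is_unit_of O u, R u &
    forall x, x \in r -> exists2 a, R a & x = a / u].
  elim: r Or {OE} => [_|x r IHr Or].
    exists 1; split=> //; last exact: (subring_one subR).
    by apply/val_unit; split; [exact: val_ring1 | exact: val_ideal1].
  have [|u [u_unit Ru ru]] := IHr; first by move=> y yr; apply: Or; rewrite inE yr orbT.
  have [a [t [Ra Rt t_unit x_at]]] := order_fraction (Or x (mem_head _ _)).
  have [[u0 _] [t0 _]] := (unit_inv u_unit, unit_inv t_unit).
  exists (u * t); split; [exact: unit_mul | exact: (subring_mul subR) |].
  move=> y; rewrite inE => /predU1P[->|/ru[b Rb ->]].
    by exists (u * a); [exact: (subring_mul subR) | rewrite x_at -mulf_div divff // mul1r].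
  by exists (b * t); [exact: (subring_mul subR) | rewrite -mulf_div divff // mulr1].
exists u; split=> //; apply/seteqP; split; last exact: adjoin_inv_sub.
have subB := ring_adjoin_subring A [set eta; u^-1].
have RB := @order_sub_adjoin [set eta; u^-1] (or_introl erefl).
rewrite [X in X `<=` _]OE; apply: ring_adjoin_min => //; first exact: ring_adjoin_base.
move=> x /= /ru[a Ra ->]; apply: (subring_mul subB); first exact: RB.
by apply: ring_adjoin_gen; right.
Qed.

(** An element t of P outside n is a unit of O_F whose inverse has a power of u as denominator; that
    power is a multiple of t, hence in P. *)
Lemma adjoin_inv_mem_primes u : is_unit_of O u -> R u ->
  O = ring_adjoin A [set eta; u^-1] ->
  forall P, prime_ideal_of R P -> ~ P `<=` n_ -> P u.
Proof.
move=> u_unit Ru OE P pP nPn; have [u0 _] := unit_inv u_unit.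
have [t Pt nt] : exists2 t, P t & ~ n_ t.
  by apply: contrapT => h; apply: nPn => t Pt; apply: contrapT => nt; apply: h; exists t.
have Rt : R t by apply: prime_ideal_sub pP _ Pt.
have [t0] := unit_inv (order_unit Rt nt).
rewrite OE => /(adjoin_invP u0 Ru)[a [m [Ra tV]]].
apply: (prime_ideal_exp (m := m) subR pP Ru).
have -> : u ^+ m = a * t.
  by rewrite -[a](divfK (expf_neq0 m u0)) -tV mulrAC mulVf // mul1r.
exact: (prime_idealM pP).
Qed.

(* If no power of u is divisible by t at the k-th embedding, the elements
   infinitely smaller than u there form a prime containing t but not u. *)
Lemma conj_power_divides u t k : R u -> u != 0 -> R t -> t != 0 ->
  ~ n_ t -> (forall P, prime_ideal_of R P -> ~ P `<=` n_ -> P u) ->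
  exists e, Ow (s k (u ^+ e / t)).
Proof.
move=> Ru u0 Rt t0 nt Pu; apply: contrapT => h.
pose P := [set x | R x /\ forall e, mw (s k (x / u ^+ e))].
have pP : prime_ideal_of R P.
  split=> [x []||x y [Rx Px] [Ry Py]|a x Ra [Rx Px]|[_ /(_ 0%N)]|x y Rx Ry [_ Pxy]] //=.
  - split=> [|e]; first exact: (subring_zero subR).
    by rewrite mul0r rmorph0; apply: val_ideal0.
  - split=> [|e]; first exact: (subring_add subR).
    by rewrite mulrDl rmorphD; apply: val_idealD.
  - split=> [|e]; first exact: (subring_mul subR).
    by rewrite -mulrA rmorphM; apply: val_idealM => //; apply: conj_order_val.
  - by rewrite expr0 divr1 rmorph1; apply: val_ideal1.
  - apply: contrapT => /not_orP[nPx nPy].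
    have notP z : R z -> ~ P z -> exists e, ~ mw (s k (z / u ^+ e)).
      move=> Rz nPz; apply: contrapT => hz; apply: nPz; split=> // e.
      by apply: contrapT => hze; apply: hz; exists e.
    have [e xe] := notP x Rx nPx; have [f yf] := notP y Ry nPy.
    have := Pxy (e + f)%N; rewrite exprD -mulf_div rmorphM.
    exact: val_ideal_mulN.
have Pt : P t.
  split=> // e; apply/val_idealE; right=> hOw; apply: h; exists e.
  by rewrite -invf_div fmorphV.
have nPn : ~ P `<=` n_ by move/(_ t Pt).
have [_ /(_ 1%N)] := Pu P pP nPn.
by rewrite expr1 divff // rmorph1; apply: val_ideal1.
Qed.

Lemma mem_primes_adjoin_inv u : R u -> ~ n_ u ->
  (forall P, prime_ideal_of R P -> ~ P `<=` n_ -> P u) ->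
  O = ring_adjoin A [set eta; u^-1].
Proof.
move=> Ru nu Pu; have u_unit := order_unit Ru nu.
apply: adjoin_inv_eq => // t Rt t_unit.
have [[u0 _] [t0 _]] := (unit_inv u_unit, unit_inv t_unit).
have nt : ~ n_ t by move=> [mt _]; case/val_unit: t_unit.
pose e k := sval (cid (conj_power_divides k Ru u0 Rt t0 nt Pu)).
have eP k : Ow (s k (u ^+ e k / t)).
  exact: (svalP (cid (conj_power_divides k Ru u0 Rt t0 nt Pu))).
(* [E] is at least every [e k], and surplus factors u stay in O_w at each embedding, so one exponent
   serves all embeddings. *)
pose E := (\sum_k e k)%N.
have EP k : Ow (s k (u ^+ E / t)).
  rewrite /E (bigD1 k) //= addnC exprD -mulrA rmorphM.
  by apply: val_ringM => //; apply: conj_order_val; apply: (subring_exp subR).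
(* Now [u ^+ E / t] is integral over O_L, so t divides a power of [u ^+ E] in R. *)
have [chi [mon_chi chiA] /conj_char_root chi0] := conj_char_poly EP.
have := integral_divides subR base_order (subring_exp subR E Ru) Rt t0 mon_chi chiA.
rewrite /root chi0 eqxx => /(_ isT)[m [a [Ra um]]].
by exists a, (E * m)%N; rewrite exprM.
Qed.

(* The primes that are restrictions of primes of the valuation ring obtained
   by restricting w along the k-th embedding. *)
Definition conj_convex k (p : set F) := forall x y, R x -> p y ->
  (exists2 c, Ow c & s k x = c * s k y) -> p x.

(** Take x in p outside q and y in q outside p. One of the two quotients of [s k x] and [s k y] is
    in O_w, and convexity then puts x in q or y in p. *)
Lemma conj_convex_chain k p q : prime_ideal_of R p -> prime_ideal_of R q ->
  conj_convex k p -> conj_convex k q -> p `<=` q \/ q `<=` p.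
Proof.
move=> pp pq cp cq; apply: contrapT => /not_orP[npq nqp].
have [x px nqx] : exists2 x, p x & ~ q x.
  by apply: contrapT => h; apply: npq => x px; apply: contrapT => nqx; apply: h; exists x.
have [y qy npy] : exists2 y, q y & ~ p y.
  by apply: contrapT => h; apply: nqp => y qy; apply: contrapT => npy; apply: h; exists y.
have [Rx Ry] : R x /\ R y.
  by split; [apply: prime_ideal_sub pp _ px | apply: prime_ideal_sub pq _ qy].
have x0 : s k x != 0.
  by rewrite fmorph_eq0; apply: contra_not_neq nqx => ->; apply: prime_ideal0 pq.
have y0 : s k y != 0.
  by rewrite fmorph_eq0; apply: contra_not_neq npy => ->; apply: prime_ideal0 pp.
case: (val_ringV w (s k x / s k y)) => h.
  by apply/nqx/(cq x y) => //; exists (s k x / s k y) => //; rewrite divfK.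
apply/npy/(cp y x) => //; exists (s k x / s k y)^-1 => //.
by rewrite invf_div divfK.
Qed.

(* Q is the prime of the valuation ring of w above the restriction of p. It
   contains the norms of the elements of p, so p lies in the union of the primes
   P k, hence in one of them, to which it is equal. *)
Lemma prime_conj_convex p : prime_ideal_of R p -> exists k, conj_convex k p.
Proof.
move=> pp.
pose Q := [set z | forall a, a \in base_pred v -> ~ p a -> mw (z / j a)].
have neq0 a : ~ p a -> a != 0.
  by move=> npa; apply: contra_not_neq npa => ->; apply: prime_ideal0 pp.
have npM a b : a \in base_pred v -> b \in base_pred v -> ~ p a -> ~ p b -> ~ p (a * b).
  by move=> Aa Ab npa npb /(prime_ideal_prime pp (base_order Aa) (base_order Ab))[].
have notQ z : ~ Q z -> exists a, [/\ a \in base_pred v, ~ p a & ~ mw (z / j a)].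
  move=> nQ; apply: contrapT => h; apply: nQ => a Aa npa.
  by apply: contrapT => nm; apply: h; exists a.
have Q0 : Q 0 by move=> a _ _; rewrite mul0r; exact: val_ideal0.
have QD x y : Q x -> Q y -> Q (x + y).
  by move=> Qx Qy a Aa npa; rewrite mulrDl; apply: val_idealD; [apply: Qx | apply: Qy].
have QM c x : Ow c -> Q x -> Q (c * x).
  by move=> Oc Qx a Aa npa; rewrite -mulrA; apply: val_idealM => //; apply: Qx.
have Q1 : ~ Q 1.
  move=> /(_ 1 (rpred1 _)) h; apply: (@val_ideal1 _ w).
  by have := h (prime_ideal_proper pp); rewrite rmorph1 divr1.
have Qprime x y : Q (x * y) -> Q x \/ Q y.
  move=> Qxy; apply: contrapT => /not_orP[/notQ[a [Aa npa ma]] /notQ[b [Ab npb mb]]].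
  apply: (val_ideal_mulN ma mb); rewrite mulf_div -rmorphM; apply: Qxy.
    exact: rpredM.
  exact: npM.
have Qp a : a \in base_pred v -> Q (j a) -> p a.
  move=> Aa Qa; apply: contrapT => npa; apply: (@val_ideal1 _ w).
  by rewrite -(divff (x := j a)) ?fmorph_eq0 ?neq0 //; apply: Qa.
(* If j(c)/j(a) were outside the maximal ideal, a/c would lie in O_L, and a, a multiple of c, in
   p. *)
have pQ c : c \in base_pred v -> p c -> Q (j c).
  move=> Ac pc a Aa npa; apply: contrapT => /val_unitV[].
  rewrite -fmorph_div fmorph_eq0 -fmorphV jO invf_div => ca0 Oac.
  have c0 : c != 0 by apply: contra_neq ca0 => ->; rewrite mul0r.
  have Aac : a / c \in base_pred v.
    rewrite inE; apply/andP; split=> //.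
    by rewrite (@rpred_div _ 1%AS) //; [case/andP: Aa | case/andP: Ac].
  by apply: npa; rewrite -(divfK c0 a); apply: (prime_idealM pp (base_order Aac)).
pose P k := [set x | R x /\ Q (s k x)].
have pP k : prime_ideal_of R (P k).
  split=> [x []||x y [Rx Qx] [Ry Qy]|a x Ra [Rx Qx]|[_]|x y Rx Ry [_]] //=.
  - by split; [exact: (subring_zero subR) | rewrite rmorph0].
  - by split; [exact: (subring_add subR) | rewrite rmorphD; apply: QD].
  - split; first exact: (subring_mul subR).
    by rewrite rmorphM; apply: QM => //; apply: conj_order_val.
  - by rewrite rmorph1.
  - by rewrite rmorphM => /Qprime[]; [left | right].
have [k pPk] : exists k, p `<=` P k.
  apply: contrapT => h.
  have [|y py nPy] := @prime_avoidance _ _ subR _ (index_enum 'I_n) P p pp pP.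
    by move=> k _ sub_pPk; apply: h; exists k.
  have Ry : R y by apply: prime_ideal_sub pp _ py.
  have [chi [mon_chi chiA] chiE] := order_conj_int Ry.
  have size_chi : (1 < size chi)%N.
    rewrite ltnNge; apply/negP => le1; have := conj_char_root chiE.
    move: mon_chi; rewrite (size1_polyC le1) hornerC monicE lead_coefC => /eqP->.
    by move/eqP; rewrite oner_eq0.
  have [q [c [_ qA Ac qE _]]] := monic_polyOver_recl mon_chi chiA size_chi.
  (* c is, up to sign, the norm of y; its integral equation makes it a multiple of y in R. *)
  have pc : p c.
    have := conj_char_root chiE; rewrite qE hornerMXaddC => /eqP.
    rewrite addrC addr_eq0 => /eqP->; rewrite -mulNr; apply: (prime_idealM pp) => //.
    apply: (subring_opp subR); apply: (subring_horner subR) => // i.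
    exact: base_order (polyOverP qA i).
  have := pQ c Ac pc; have -> : j c = \prod_k - s k y.
    have := congr1 (fun f => f.[0]) chiE; rewrite qE -[X in _.[X]](rmorph0 j).
    rewrite horner_map hornerMXaddC mulr0 add0r => ->; rewrite horner_prod.
    by apply: eq_bigr => k _; rewrite hornerXsubC sub0r.
  have nQy k : ~ Q (s k y) by move=> Qk; apply: (nPy k); rewrite ?mem_index_enum.
  (* By primality Q contains some [s k y], against the choice of y. *)
  elim: (index_enum _) => [|k r IHr]; first by rewrite big_nil.
  rewrite big_cons => /Qprime[Qk|//]; apply: (nQy k).
  rewrite -[s k y]opprK -mulN1r; apply: QM => //.
  by apply: val_ringN; exact: val_ring1.
(* [P k] lies in p by incomparability, and it is convex because Q is stable under multiplication by
   O_w. *)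
exists k => x y Rx py [c Oc xy].
apply: (order_incomparable pp (pP k) pPk) => [a Aa [_]|].
  by rewrite conj_base; [exact: Qp | case/andP: Aa].
by split=> //; rewrite xy; apply: QM => //; case: (pPk y py).
Qed.

Lemma chain_cond_mem_primes :
  (forall (I : Type) (P : I -> set F),
     (forall i, prime_ideal_of R (P i)) ->
     (forall i j, P i `<=` P j \/ P j `<=` P i) ->
     (forall i, ~ P i `<=` n_) ->
     ~ R `&` \bigcap_i P i `<=` n_) ->
  exists u, (R `\` n_) u /\ forall P, prime_ideal_of R P -> ~ P `<=` n_ -> P u.
Proof.
move=> chains.
have chain_elt k : exists u, [/\ R u, ~ n_ u & forall P,
    prime_ideal_of R P -> ~ P `<=` n_ -> conj_convex k P -> P u].
  (* All primes not inside n that are convex at k, indexed by themselves; they form a chain,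
     possibly empty. *)
  pose I := {P | [/\ prime_ideal_of R P, ~ P `<=` n_ & conj_convex k P]}.
  have := chains I sval.
  have h1 (i : I) : prime_ideal_of R (sval i) by case: (svalP i).
  have h2 (i l : I) : sval i `<=` sval l \/ sval l `<=` sval i.
    have [[p1 _ c1] [p2 _ c2]] := (svalP i, svalP l).
    exact: conj_convex_chain p1 p2 c1 c2.
  have h3 (i : I) : ~ sval i `<=` n_ by case: (svalP i).
  move=> /(_ h1 h2 h3) nn; apply: contrapT => h; apply: nn => u [Ru cap_u].
  apply: contrapT => nu; apply: h; exists u; split=> // P pP nP cP.
  exact: (cap_u (exist _ P (And3 pP nP cP))).
pose u k := sval (cid (chain_elt k)).
have uP k : [/\ R (u k), ~ n_ (u k) & forall P,
    prime_ideal_of R P -> ~ P `<=` n_ -> conj_convex k P -> P (u k)].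
  exact: (svalP (cid (chain_elt k))).
have Ru k : R (u k) by case: (uP k).
exists (\prod_k u k); split.
  split; first exact: (subring_prod subR).
  by apply: (prime_ideal_prod subR center_prime) => // k; case: (uP k).
move=> P pP nP; have [k cP] := prime_conj_convex pP.
rewrite (bigD1 k) //=; apply: (prime_ideal_mulr pP).
  exact: (subring_prod subR).
by case: (uP k) => _ _; apply.
Qed.

(** * Henselian generators *)

Lemma henselian_inv b f : f \is a polyOver (base_pred v) -> root f b ->
  is_unit_of O b -> is_unit_of O f^`().[b] -> henselian_over A O b^-1.
Proof.
move=> fA /eqP fb b_unit f'b_unit; have [b0 Ob] := unit_inv b_unit.
have bV_unit : is_unit_of O b^-1.
  by split=> //; exists b; [case: b_unit | rewrite mulVf].
(* The reciprocal polynomial of f is the witness for 1/b; taking [size f] instead of the degree only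
   adds a factor X. *)
pose m := size f; have [] := @reciprocal_poly _ f b m (leqnSn _) b0.
set g := \sum_(i < _) _; rewrite fb mulr0 mul0rn sub0r => gb g'b.
have expU c l : is_unit_of O c -> is_unit_of O (c ^+ l).
  move=> cU; elim: l => [|l IHl]; last by rewrite exprS; apply: unit_mul.
  by rewrite expr0; apply/val_unit; split; [exact: val_ring1 | exact: val_ideal1].
have N1_unit : is_unit_of O (-1).
  have O1 := val_ringN (val_ring1 v).
  by split=> //; exists (-1) => //; rewrite mulrNN mulr1.
split=> //; exists g; split.
- rewrite polyOver_base; apply: rpred_sum => i _; apply: polyOverZ.
    exact: (polyOverP fA).
  by apply: rpredX; apply: polyOverX.
- by move/eqP: gb; rewrite mulf_eq0 expf_eq0 (negPf b0) andbF orbF.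
- rewrite -[_.[_]](mulfK (expf_neq0 m b0)) g'b -mulN1r -exprVn.
  by do !apply: unit_mul => //; apply: expU.
Qed.

(* t is chosen such that u t is congruent to eta modulo n and lies in every
   maximal ideal {mw (s k x)} other than n. *)
Lemma separating_multiple u : R u -> ~ n_ u -> exists t,
  [/\ R t, ~ n_ (u * t) & forall k, k != k0 -> ~ mw (j (u * t) - s k (u * t))].
Proof.
move=> Ru nu.
have sep k : exists z, [/\ R z, ~ n_ z & n_ `<=` [set x | R x /\ mw (s k x)] \/ mw (s k z)].
  have [le|nle] := pselect (n_ `<=` [set x | R x /\ mw (s k x)]).
    exists 1; split; [exact: (subring_one subR) | | by left].
    exact: (prime_ideal_proper center_prime).
  (* By incomparability, a center that does not contain n has an element outside n. *)
  apply: contrapT => h; apply: nle.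
  apply: (order_incomparable (conj_ideal_prime k) center_prime).
    move=> z [Rz mz]; apply: contrapT => nz; apply: h.
    by exists z; split=> //; right.
  move=> a Aa [ma _]; split; first exact: base_order.
  by rewrite conj_base ?conj_ideal //; case/andP: Aa.
pose z k := sval (cid (sep k)).
have zP k : [/\ R (z k), ~ n_ (z k) &
    n_ `<=` [set x | R x /\ mw (s k x)] \/ mw (s k (z k))].
  exact: (svalP (cid (sep k))).
have Rz k : R (z k) by case: (zP k).
pose y := u * \prod_k z k.
have Rprod r : R (\prod_(k <- r) z k) by apply: (subring_prod subR).
have Ry : R y by apply: (subring_mul subR).
have ny : ~ n_ y.
  move=> /(prime_ideal_prime center_prime Ru (Rprod _))[//|].
  by apply: (prime_ideal_prod subR center_prime) => // k; case: (zP k).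
have [t Rt nyt] := center_maximal Ry ny.
have n1 : n_ (y * (t * eta) - eta).
  have -> : y * (t * eta) - eta = eta * (y * t - 1).
    by rewrite mulrBr mulr1 mulrA [eta * _]mulrC.
  exact: (prime_idealM center_prime order_eta).
exists ((\prod_k z k) * (t * eta)).
have Rt' : R (t * eta) by apply: (subring_mul subR) => //; exact: order_eta.
have nx : ~ n_ (u * (\prod_k z k * (t * eta))).
  rewrite mulrA => nx; have [_] : is_unit_of O eta /\ ~ val_ideal v eta.
    by split=> //; case/val_unit: eta_unit.
  apply; rewrite -[eta](subKr (y * (t * eta))).
  by case: (prime_idealB subR center_prime nx n1).
split=> //; first exact: (subring_mul subR).
move=> k kk0; set x := u * _ in nx *.
have Rx : R x := subring_mul subR Ru (subring_mul subR (Rprod _) Rt').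
have x_eta : n_ (x - eta) by rewrite /x mulrA.
have mjx : ~ mw (j x) by move=> /conj_ideal mx; apply: nx.
(* If the factor [z k] was chosen in the center at k, then [s k x] is in m_w while [j x] is not. *)
have [_ _ [le|mz]] := zP k; last first.
  have mx : mw (s k x).
    rewrite /x (bigD1 k) //= -[z k * _ * _]mulrA mulrCA rmorphM mulrC.
    apply: val_idealM mz; apply: conj_order_val; apply: (subring_mul subR) => //.
    apply: (subring_mul subR) => //; exact: (subring_prod subR).
  by move=> /val_idealD/(_ mx); rewrite subrK.
(* The center at k contains n, so x may be replaced by eta in the difference; but [j eta - s k eta]
   is a factor of the unit h'(eta). *)
move=> mjs; have [_ mkx] := le _ x_eta.
have mjx' : mw (j (x - eta)) by apply/conj_ideal; case: x_eta.
have : mw (j eta - s k eta).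
  have -> : j eta - s k eta = j x - s k x + s k (x - eta) - j (x - eta).
    by rewrite !rmorphB subrKA opprB [RHS]addrC subrKA.
  apply: val_idealD; first exact: val_idealD.
  by rewrite -mulN1r; apply: val_idealM => //; apply/val_ringN/val_ring1.
have [Oh' /val_unitV[h'0 Oh'V]] := proj1 (val_unit _ _) h'_unit.
have := conj_char_deriv h_roots; rewrite (bigD1 k) //= => h'E meta.
case/val_unit: h'_unit => _; apply; apply/conj_ideal; rewrite h'E mulrC.
apply: val_idealM => //; apply: (subring_prod subOw) => l _.
by apply: (subring_sub subOw); rewrite -?sk0; apply: conj_eta_val.
Qed.

Lemma adjoin_inv_henselian u : is_unit_of O u -> R u ->
  O = ring_adjoin A [set eta; u^-1] ->
  exists r, henselian_over A O r /\ O = ring_adjoin A [set eta; r; r].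
Proof.
move=> u_unit Ru OE; have nu : ~ n_ u by move=> [mu _]; case/val_unit: u_unit.
have [t [Rt nut sep_ut]] := separating_multiple Ru nu.
have Rut : R (u * t) by apply: (subring_mul subR).
have ut_unit := order_unit Rut nut.
have [u0 Ou] := unit_inv u_unit; have [ut0 Out] := unit_inv ut_unit.
have [chi [_ chiA] chiE] := order_conj_int Rut.
exists (u * t)^-1; split.
  apply: (henselian_inv chiA) => //; first exact/eqP/conj_char_root.
  (* chi'(u t) is the product of the differences between u t and its other conjugates, which
     [separating_multiple] keeps outside m_w. *)
  have jchi := conj_char_deriv chiE; apply/val_unit; split.
    apply/jO; rewrite jchi; apply: (subring_prod subOw) => k _.
    by apply: (subring_sub subOw); rewrite -?sk0; apply: conj_order_val.
  rewrite -conj_ideal jchi; apply: (big_ind (fun z => ~ mw z)) => //; first exact: val_ideal1.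
  exact: val_ideal_mulN.
apply/seteqP; split.
  set B := ring_adjoin A _; have subB : GRing.subring_closed (mem B) by apply: ring_adjoin_subring.
  have RB : R `<=` B by apply: order_sub_adjoin; left; left.
  rewrite [X in X `<=` _]OE; apply: ring_adjoin_min => //; first exact: ring_adjoin_base.
  move=> _ [->|->]; first exact: (RB _ order_eta).
  have -> : u^-1 = t * (u * t)^-1.
    by move: ut0; rewrite mulf_eq0 negb_or => /andP[_ t0]; rewrite invfM mulrCA divff // mulr1.
  apply: (subring_mul subB); first exact: RB.
  by apply: ring_adjoin_gen; right.
apply: ring_adjoin_min => //; first by move=> a [].
by move=> _ [[->|->]|->] //; case: eta_unit.
Qed.

End Conjugates.

Theorem theorem1p6 (L : fieldType) (F : fieldExtType L) (v : valuation F)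
    (eta : F) :
  let OF := val_ring v in
  let OL := base_val_ring v in
  let h := minPoly 1 eta in
  let OLeta := ring_adjoin OL [set eta] in
  let n := val_ideal v `&` OLeta in
  inertial_extension v ->
  OF eta ->
  <<1; eta>>%VS = fullv ->
  h \is a polyOver (mem OL) ->
  is_unit_of OF eta ->
  is_unit_of OF h^`().[eta] ->
  [<-> (* (i) *)
       finitely_generated_algebra OL OF;
       (* (ii) *)
       exists u, [/\ is_unit_of OF u, OLeta u &
                     OF = ring_adjoin OL [set eta; u^-1]];
       (* (iii) *)
       exists r s, [/\ henselian_over OL OF r, henselian_over OL OF s &
                       OF = ring_adjoin OL [set eta; r; s]];
       (* (iv) *)
       exists u, (OLeta `\` n) u /\
         forall P, prime_ideal_of OLeta P -> ~ P `<=` n -> P u;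
       (* (v): intersecting with OLeta matters only for the empty chain *)
       forall (I : Type) (P : I -> set F),
         (forall i, prime_ideal_of OLeta (P i)) ->
         (forall i j, P i `<=` P j \/ P j `<=` P i) ->
         (forall i, ~ P i `<=` n) ->
         ~ OLeta `&` \bigcap_i P i `<=` n].
Proof.
move=> OF OL h OLeta n [K [j [w [sepK /val_extends_ring jO _]]]] _ gen_eta.
rewrite polyOver_base => hA eta_unit h'_unit.
have [h'0 _] := unit_inv h'_unit.
have [m [s [sj s_inj [k0 sk0] h_roots]]] := conjugate_embeddings sepK gen_eta h'0.
(* Stated separately, since (iii) also leads to (iv) by way of (ii). *)
have fg_ii : finitely_generated_algebra OL OF -> exists u,
    [/\ is_unit_of OF u, OLeta u & OF = ring_adjoin OL [set eta; u^-1]].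
  exact: fg_adjoin_inv gen_eta jO sj s_inj h_roots hA eta_unit h'_unit.
tfae.
- exact: fg_ii.
- move=> [u [u_unit Ru OE]].
  have [r [hr rE]] := adjoin_inv_henselian gen_eta jO sj s_inj sk0 h_roots hA
    eta_unit h'_unit u_unit Ru OE.
  by exists r, r.
(* (iii) provides finitely many generators, hence (ii), whose unit lies in every prime not contained
   in n. *)
- move=> [r [s' [_ _ OE]]]; have [|u [u_unit Ru OE']] := fg_ii.
    by exists [set eta; r; s']; split=> //; rewrite !finite_setU; split=> //; split.
  exists u; split; first by split=> // -[mu _]; case/val_unit: u_unit.
  move=> P pP nP.
  exact: (adjoin_inv_mem_primes jO sj sk0 h_roots hA u_unit Ru OE' pP nP).
- move=> [u [[Ru nu] Pu]] I P pP _ nP /(_ u) le; apply: nu; apply: le.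
  by split=> // i _; apply: Pu.
(* The chains yield the element u of (iv), and its inverse together with eta generates O_F. *)
- move=> chains; have [u [[Ru nu] Pu]] :=
    chain_cond_mem_primes gen_eta jO sj s_inj sk0 h_roots hA chains.
  exists [set eta; u^-1]; split; first by rewrite finite_setU.
  exact: (mem_primes_adjoin_inv gen_eta jO sj s_inj sk0 h_roots hA eta_unit h'_unit
    Ru nu Pu).
Qed.
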